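(* Let a braided set $(X,\sigma)$ act trivially on a commutative ring $\Bbbk$. Let $p,q\ge0$ with $p+q\ge2$. For all maps $f\colon X^{\times p}\to\Bbbk$ and $g\colon X^{\times q}\to\Bbbk$, the circle product $\circ$ and the cup product $\smile$ of braided cochains satisfy $$d^{p+q}(f\circ g)-(-1)^{q-1}(d^{p+1}f)\circ g-f\circ(d^{q+1}g)=(-1)^q\big(g\smile f-(-1)^{pq}f\smile g\big).$$
   Context: A braided set $(X,\sigma)$ is a set $X$ with a (not necessarily invertible) map $\sigma\colon X^{\times 2}\to X^{\times 2}$ satisfying $(\sigma\times \mathrm{Id})(\mathrm{Id}\times\sigma)(\sigma\times \mathrm{Id})=(\mathrm{Id}\times\sigma)(\sigma\times \mathrm{Id})(\mathrm{Id}\times\sigma)$ on $X^{\times 3}$. Let $b_i$ ($1\le i\le k-1$) act on $X^{\times k}$ by $\mathrm{Id}^{\times(i-1)}\times\sigma\times \mathrm{Id}^{\times(k-i-1)}$ (an action of the positive braid monoid); in products, the rightmost factor acts first. Words of length $k$ in $X$ are identified with elements of $X^{\times k}$. For $s\in S_k$ with a shortest expression $s=s_{i_1}\cdots s_{i_t}$ in the adjacent transpositions $s_i=(i\;i+1)$, put $T_s=b_{i_1}\cdots b_{i_t}$ and $|s|=t$. Put $Sh_{p,q}=\{s\in S_{p+q}\mid s(1)<\cdots<s(p),\ s(p+1)<\cdots<s(p+q)\}$. **Cochains.** $C^k=\mathrm{Map}(X^{\times k},\Bbbk)$, $k\ge0$ (with $C^0=\Bbbk$). For $k>0$, $1\le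 i\le k$, define maps $C^{k-1}\to C^k$ by $(d_l^{k;i}f)(x_1,\ldots,x_k)=f(x'_1,\ldots,x'_{i-1},x_{i+1},\ldots,x_k)$ with $x'_ix'_1\ldots x'_{i-1}=b_1\cdots b_{i-1}(x_1\ldots x_i)$, and $(d_r^{k;i}f)(x_1,\ldots,x_k)=f(x_1,\ldots,x_{i-1},x''_{i+1},\ldots,x''_k)$ with $x''_{i+1}\ldots x''_kx''_i=b_{k-i}\cdots b_1(x_i\ldots x_k)$. The braided differential (trivial actions) is $d^k=\sum_{i=1}^k(-1)^{i-1}(d_l^{k;i}-d_r^{k;i})\colon C^{k-1}\to C^k$. **Cup product.** For $f\in C^p$, $g\in C^q$: $f\smile g=\sum_{s\in Sh_{p,q}}(-1)^{|s|}\,(f\cdot g)\circ T_{s^{-1}}\in C^{p+q}$, where here $(f\cdot g)(x_1,\ldots,x_{p+q})=f(x_1,\ldots,x_p)\,g(x_{p+1},\ldots,x_{p+q})$ and $\circ$ in this formula denotes composition of maps. **Circle product.** For $f,g\in C^k$ let $(f\ast g)(\boldsymbol w)=f(\boldsymbol w)g(\boldsymbol w)$. For disjoint subsets $L,R\subseteq\{1,\ldots,k\}$, let $\langle L,R\rangle$ be the number of pairs $(i,j)\in L\times R$ with $i>j$. Write $L\sqcup R=\{i_1<\cdots<i_t\}$ and put $\omega_s=l$ if $i_s\in L$, $\omega_s=r$ if $i_s\in R$; define $d^{k;L,R}=d^{k;i_t}_{\omega_t}\cdots d^{k-t+1;i_1}_{\omega_1}\colon C^{k-t}\to C^k$ (the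 identity if $L\sqcup R=\emptyset$). For $k=p+q-1>0$, the circle product $\circ\colon C^p\times C^q\to C^k$ is $$f\circ g=\sum(-1)^{(q-1)\#J_1+\langle J_1,I_1\rangle+\langle I_2,J_2\rangle}\,d^{k;I_2,I_1}(f)\ast d^{k;J_1,J_2}(g),$$ the sum being over all $t\in\{1,\ldots,k\}$ and all decompositions $\{1,\ldots,t-1\}=I_1\sqcup J_1$, $\{t+1,\ldots,k\}=I_2\sqcup J_2$ with $\#I_1+\#I_2=q-1$, $\#J_1+\#J_2=p-1$ (an empty sum is $0$). *)

(* Defs.v *)
From HB Require Import structures.
From mathcomp Require Import all_boot all_order all_algebra all_fingroup.

Set Implicit Arguments.
Unset Strict Implicit.
Unset Printing Implicit Defensive.

Import GRing.Theory.
Local Open Scope ring_scope.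

(* All positions are 0-based: 'I_k stands for {1, ..., k}, and the index i of  *)
(* s_i, b_i, d^{k;i} below is the index i + 1 of the usual 1-based notation.   *)

Definition sigma12 (X : Type) (sigma : X * X -> X * X) (w : X * X * X) :
  X * X * X := (sigma w.1, w.2).

Definition sigma23 (X : Type) (sigma : X * X -> X * X) (w : X * X * X) :
  X * X * X :=
  (w.1.1, (sigma (w.1.2, w.2)).1, (sigma (w.1.2, w.2)).2).

Definition braided (X : Type) (sigma : X * X -> X * X) : Prop :=
  forall w : X * X * X,
    sigma12 sigma (sigma23 sigma (sigma12 sigma w)) =
    sigma23 sigma (sigma12 sigma (sigma23 sigma w)).

(* The identity on words with fewer than i + 2 letters. *)
Definition braid (X : Type) (sigma : X * X -> X * X) (i : nat) (w : seq X) :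
  seq X :=
  take i w ++
  (if drop i w is x :: y :: v then [:: (sigma (x, y)).1, (sigma (x, y)).2 & v]
   else drop i w).

(* [:: i_1; ...; i_t] acts by b_{i_1} ... b_{i_t}, rightmost factor first. *)
Definition braid_word (X : Type) (sigma : X * X -> X * X) (u : seq nat)
  (w : seq X) : seq X := foldr (braid sigma) w u.

Lemma size_braid (X : Type) (sigma : X * X -> X * X) i (w : seq X) :
  size (braid sigma i w) = size w.
Proof.
rewrite -[w in RHS](cat_take_drop i) /braid !size_cat.
by case: (drop i w) => [|x [|y v]].
Qed.

Lemma size_braid_word (X : Type) (sigma : X * X -> X * X) u (w : seq X) :
  size (braid_word sigma u w) = size w.
Proof. by elim: u => //= i u IHu; rewrite size_braid. Qed.

Fact braid_word_tupleP (X : Type) (sigma : X * X -> X * X) (u : seq nat)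
  (k : nat) (w : k.-tuple X) : size (braid_word sigma u w) == k.
Proof. by rewrite size_braid_word size_tuple. Qed.

Fact adj_subproof1 (k : nat) (i : 'I_k.-1) : (i < k)%N.
Proof. by case: k i => [|k] [i Hi] //=; apply: ltnW. Qed.

Fact adj_subproof2 (k : nat) (i : 'I_k.-1) : (i.+1 < k)%N.
Proof. by case: k i => [|k] [i Hi]. Qed.

Definition adj (k : nat) (i : 'I_k.-1) : 'S_k :=
  tperm (Ordinal (adj_subproof1 i)) (Ordinal (adj_subproof2 i)).

(* s_{i_1} ... s_{i_t} as a composite of functions, rightmost factor first;    *)
(* the group law of 'S_k composes in the opposite order, hence the rev.        *)
Definition perm_of_word (k : nat) (u : seq 'I_k.-1) : 'S_k :=
  (\prod_(i <- rev u) adj i)%g.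

Lemma perm_of_word_cat k (u v : seq 'I_k.-1) :
  perm_of_word (u ++ v) = (perm_of_word v * perm_of_word u)%g.
Proof. by rewrite /perm_of_word rev_cat big_cat. Qed.

Lemma perm_of_word1 k (i : 'I_k.-1) : perm_of_word [:: i] = adj i.
Proof. by rewrite /perm_of_word big_seq1. Qed.

Lemma perm_of_word_tperm k (i j : 'I_k) :
  (i < j)%N -> exists u, perm_of_word u = tperm i j.
Proof.
case: k i j => [[] //|k] i [j Hj] /=.
elim: j Hj => [//|j IHj] Hj; rewrite ltnS => le_ij.
have Hj' : (j < k.+1)%N by apply: ltnW.
pose a : 'I_k.+1.-1 := Ordinal (Hj : (j < k)%N).
have adjE : adj a = tperm (Ordinal Hj') (Ordinal Hj).
  by rewrite /adj; congr tperm; apply: val_inj.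
have [eq_ij | neq_ij] := eqVneq (i : nat) j.
  exists [:: a]; rewrite perm_of_word1 adjE; congr tperm.
  exact: val_inj.
have lt_ij : (i < j)%N by rewrite ltn_neqAle neq_ij.
have [u Hu] := IHj Hj' lt_ij.
exists ([:: a] ++ (u ++ [:: a])).
rewrite !perm_of_word_cat perm_of_word1 Hu adjE -mulgA.
have := tpermJ i (Ordinal Hj') (tperm (Ordinal Hj') (Ordinal Hj)).
rewrite tpermL conjgE tpermV => ->; rewrite tpermD //.
  by rewrite -val_eqE /= eq_sym.
by rewrite -val_eqE /= neq_ltn ltnS le_ij orbT.
Qed.

Lemma perm_of_word_surj k (s : 'S_k) : exists u, perm_of_word u = s.
Proof.
have [ts -> Hts] := prod_tpermP s.
elim: ts Hts => [|[i j] ts IHts] /=.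
  by exists [::]; rewrite /perm_of_word !big_nil.
move=> /andP[/= ne_ij /IHts[u Hu]].
have [v Hv] : exists v, perm_of_word v = tperm i j.
  move: ne_ij; rewrite /dpair /= -val_eqE neq_ltn => /orP[]; first exact: perm_of_word_tperm.
  by rewrite tpermC; apply: perm_of_word_tperm.
by exists (u ++ v); rewrite perm_of_word_cat big_cons Hu Hv.
Qed.

Fact perm_length_subproof (k : nat) (s : 'S_k) :
  exists n, [exists u : n.-tuple 'I_k.-1, perm_of_word u == s].
Proof.
have [u Hu] := perm_of_word_surj s.
by exists (size u); apply/existsP; exists (in_tuple u); apply/eqP.
Qed.

(* |s|: the length of a shortest expression of s *)
Definition perm_length (k : nat) (s : 'S_k) : nat :=
  ex_minn (perm_length_subproof s).

Fact reduced_subproof (k : nat) (s : 'S_k) :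
  exists u : (perm_length s).-tuple 'I_k.-1, perm_of_word u == s.
Proof. by rewrite /perm_length; case: ex_minnP => n /existsP. Qed.

(* A shortest expression of s; by Matsumoto's theorem the operator T_perm s   *)
(* does not depend on which one is chosen when sigma is braided.               *)
Definition reduced (k : nat) (s : 'S_k) : seq 'I_k.-1 :=
  xchoose (reduced_subproof s).

Definition T_perm (X : Type) (sigma : X * X -> X * X) (k : nat) (s : 'S_k)
  (w : k.-tuple X) : k.-tuple X :=
  Tuple (braid_word_tupleP sigma [seq val i | i <- reduced s] w).

Definition shuffle (p q : nat) (s : 'S_(p + q)) : bool :=
  [forall i : 'I_p, forall j : 'I_p,
     (i < j)%N ==> (s (lshift q i) < s (lshift q j))%N] &&
  [forall i : 'I_q, forall j : 'I_q,
     (i < j)%N ==> (s (rshift p i) < s (rshift p j))%N].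

Definition cochain (X : Type) (K : comPzRingType) (k : nat) : Type :=
  k.-tuple X -> K.

(* The word x'_1 ... x'_{i-1} x_{i+1} ... x_k of the left face: the letter     *)
(* x_i is moved to the front by b_1 ... b_{i-1}, then deleted.                 *)
Definition face_l (X : Type) (sigma : X * X -> X * X) (i : nat) (w : seq X) :
  seq X :=
  behead (braid_word sigma (iota 0 i) (take i.+1 w)) ++ drop i.+1 w.

(* The word x_1 ... x_{i-1} x''_{i+1} ... x''_k of the right face: the letter  *)
(* x_i is moved to the end by b_{k-i} ... b_1, then deleted.                   *)
Definition face_r (X : Type) (sigma : X * X -> X * X) (i : nat) (w : seq X) :
  seq X :=
  take (size w).-1
    (take i w ++ braid_word sigma (rev (iota 0 (size w - i.+1))) (drop i w)).

Fact face_l_tupleP (X : Type) (sigma : X * X -> X * X) (k i : nat)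
  (w : k.-tuple X) : size (face_l sigma i w) == k.-1.
Proof.
rewrite /face_l size_cat size_behead size_braid_word size_drop.
rewrite size_take_min size_tuple.
case: k w => [|k] w; first by rewrite minn0.
rewrite minnSS subSS /=; case: (leqP i k) => [/subnKC -> //|lt_ki].
by rewrite (eqP (ltnW lt_ki)) addn0.
Qed.

Fact face_r_tupleP (X : Type) (sigma : X * X -> X * X) (k i : nat)
  (w : k.-tuple X) : size (face_r sigma i w) == k.-1.
Proof.
rewrite /face_r size_take_min size_cat size_braid_word -size_cat.
by rewrite cat_take_drop size_tuple; apply/eqP/minn_idPl/leq_pred.
Qed.

(* d_l^{k;i}, d_r^{k;i} : C^{k-1} -> C^k *)
Definition d_l (X : Type) (sigma : X * X -> X * X) (K : comPzRingType)
  (k i : nat) (f : cochain X K k.-1) : cochain X K k :=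
  fun w => f (Tuple (face_l_tupleP sigma i w)).

Definition d_r (X : Type) (sigma : X * X -> X * X) (K : comPzRingType)
  (k i : nat) (f : cochain X K k.-1) : cochain X K k :=
  fun w => f (Tuple (face_r_tupleP sigma i w)).

Definition diff (X : Type) (sigma : X * X -> X * X) (K : comPzRingType)
  (k : nat) (f : cochain X K k.-1) : cochain X K k :=
  fun w => \sum_(i < k) (-1) ^+ i * (d_l sigma i f w - d_r sigma i f w).

Definition concat (X : Type) (K : comPzRingType) (p q : nat)
  (f : cochain X K p) (g : cochain X K q) : cochain X K (p + q) :=
  fun w => f [tuple tnth w (lshift q i) | i < p] *
           g [tuple tnth w (rshift p i) | i < q].

Definition cup (X : Type) (sigma : X * X -> X * X) (K : comPzRingType)
  (p q : nat) (f : cochain X K p) (g : cochain X K q) : cochain X K (p + q) :=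
  fun w => \sum_(s : 'S_(p + q) | shuffle s)
    (-1) ^+ perm_length s * concat f g (T_perm sigma s^-1%g w).

(* <L, R> *)
Definition bracket (k : nat) (L R : {set 'I_k}) : nat :=
  #|[set ij in setX L R | (ij.2 < ij.1)%N]|.

(* For u = [:: (i_1, o_1); ...; (i_t, o_t)], where o = true stands for l and   *)
(* o = false for r: the composite d^{k;i_t}_{o_t} ... d^{k-t+1;i_1}_{o_1}, of  *)
(* source degree k - t = iter t predn k (when t <= k).                         *)
Fixpoint d_word (X : Type) (sigma : X * X -> X * X) (K : comPzRingType)
  (k : nat) (u : seq (nat * bool)) :
  cochain X K (iter (size u) predn k) -> cochain X K k :=
  if u is a :: v then fun f =>
    d_word sigma (if a.2 then d_l sigma a.1 f else d_r sigma a.1 f)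
  else fun f => f.

(* Transport between equal degrees, by zero between different ones. *)
Definition recast (X : Type) (K : comPzRingType) (p m : nat)
  (f : cochain X K p) : cochain X K m :=
  fun w => if insub (val w) is Some v then f v else 0.

(* enum lists L :|: R in increasing order. *)
Definition LR_word (k : nat) (L R : {set 'I_k}) : seq (nat * bool) :=
  [seq (val i, i \in L) | i <- enum (L :|: R)].

(* d^{k;L,R} on C^p; only used for disjoint L, R and p = k - #|L :|: R|, so    *)
(* that recast is the identity up to conversion of degrees.                    *)
Definition d_LR (X : Type) (sigma : X * X -> X * X) (K : comPzRingType)
  (p k : nat) (L R : {set 'I_k}) (f : cochain X K p) : cochain X K k :=
  d_word sigma (u := LR_word L R) (recast f).

(* {1, ..., t-1} = I1 + J1 and {t+1, ..., k} = I2 + J2 (disjoint unions)       *)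
(* with #I1 + #I2 = q - 1 and #J1 + #J2 = p - 1; the last two are written      *)
(* without subtraction, so that there is no solution if p = 0 or q = 0.        *)
Definition decomposition (p q k : nat) (t : 'I_k) (I1 J1 I2 J2 : {set 'I_k}) :
  bool :=
  [&& I1 :|: J1 == [set i : 'I_k | (i < t)%N], [disjoint I1 & J1],
      I2 :|: J2 == [set i : 'I_k | (t < i)%N], [disjoint I2 & J2],
      (#|I1| + #|I2|).+1 == q & (#|J1| + #|J2|).+1 == p].

(* In the exponent q.-1 is q - 1, as every nonzero term has q > 0. *)
Definition circle (X : Type) (sigma : X * X -> X * X) (K : comPzRingType)
  (p q : nat) (f : cochain X K p) (g : cochain X K q) :
  cochain X K (p + q).-1 :=
  fun w =>
    \sum_(t < (p + q).-1)
    \sum_(I1 : {set 'I_(p + q).-1}) \sum_(J1 : {set 'I_(p + q).-1})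
    \sum_(I2 : {set 'I_(p + q).-1}) \sum_(J2 : {set 'I_(p + q).-1}
                                          | decomposition p q t I1 J1 I2 J2)
      (-1) ^+ (q.-1 * #|J1| + bracket J1 I1 + bracket I2 J2) *
      (d_LR sigma I2 I1 f w * d_LR sigma J1 J2 g w).

(* C^p x C^{q+1} -> C^{p+q} : the two expressions of the degree agree. *)
Fact circle_degreeS (p q : nat) : (p + q = (p + q.+1).-1)%N.
Proof. by rewrite addnS. Qed.

(* Main.v *)
(* The faces of words satisfy the precubical identities, so a word w of length *)
(* n is an abstract n-cube whose faces are the words in {l, r, s}^n, where s   *)
(* marks a free direction. Every term of the identity is a sign times the      *)
(* value of f at one face of w times the value of g at another one, hence the  *)
(* value of one functional on a word in pairs of symbols. Put a = - sl - rs, b *)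
(* = ls + sr, c = ss and e = ll - rr, where xy stands for the pair (x, y). Up  *)
(* to Koszul signs, the circle product is the sum of the words a^i c b^j, and  *)
(* the two cup products are a^n and b^n. The differential D of the cube        *)
(* satisfies D a = - e, D b = e and D c = a + b. Hence D (sum a^i c b^j)       *)
(* telescopes to b^n - (-1)^n a^n, up to words with one letter e, and these    *)
(* are the terms of d (f o g). For the cup products, shuffles are identified   *)
(* with the sets of letters that they bring to the front; every shortest       *)
(* expression of an inverse shuffle only exchanges letters that are out of     *)
(* order, so that its action is given by faces and Matsumoto's theorem is not  *)
(* needed.                                                                     *)

Require Import Defs.
From HB Require Import structures.
From mathcomp Require Import all_boot all_order all_algebra all_fingroup.
From mathcomp Require Import zify ring.

Set Implicit Arguments.
Unset Strict Implicit.
Unset Printing Implicit Defensive.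

Import GRing.Theory.
Local Open Scope ring_scope.

Arguments face_l : simpl never.
Arguments face_r : simpl never.

(** * Precubical identities *)

Section Faces.

Variables (X : Type) (sigma : X * X -> X * X).

(** Words in pairs of symbols are cells of a product of two [n]-cubes with interleaved coordinates,
    and every operator below is transposed to functionals on such words. With S_n the sum of the
    words a^i c b^j, i + j = n - 1, one has S_{n+1} = a S_n + c b^n, whence D S_n = b^n - (-1)^n a^n
    - E_n, where E_n consists of words with one letter e ([evalS_fdiff]). This is evaluated at
    [Psi f g w]: D obeys the Leibniz rule ([fdiff_Psi]) and gives (d f) o g and f o (d g); the
    letter e deletes the same letter of [w] for both factors, so E_n gives d (f o g) ([insS_Psi]);
    [circle_evalS], [cup_evalA] and [cup_evalB] identify S_n, a^n and b^n with the products. The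
    braid relation enters only through [face_face]. *)

Definition face (o : bool) (i : nat) (w : seq X) : seq X :=
  if o then face_l sigma i w else face_r sigma i w.

Lemma size_face o i (w : seq X) : size (face o i w) = (size w).-1.
Proof.
by case: o; [apply/eqP/(face_l_tupleP sigma i (in_tuple w))
            |apply/eqP/(face_r_tupleP sigma i (in_tuple w))].
Qed.

(* pull moves letter i of x :: w to the front; push moves x through w and      *)
(* deletes it.                                                                 *)
Fixpoint pull (i : nat) (x : X) (w : seq X) : X * seq X :=
  match i, w with
  | i'.+1, y :: w' => let zv := pull i' y w' in
      ((sigma (x, zv.1)).1, (sigma (x, zv.1)).2 :: zv.2)
  | _, _ => (x, w)
  end.

Arguments pull !i x !w / : simpl nomatch.

Fixpoint push (x : X) (w : seq X) : seq X :=
  if w is y :: w' then (sigma (x, y)).1 :: push (sigma (x, y)).2 w' else [::].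

Lemma braid_wordS u x (w : seq X) :
  braid_word sigma (map S u) (x :: w) = x :: braid_word sigma u w.
Proof. by elim: u => //= i u ->; rewrite /braid /=. Qed.

Lemma braid_word_cat u v (w : seq X) :
  braid_word sigma (u ++ v) w = braid_word sigma u (braid_word sigma v w).
Proof. exact: foldr_cat. Qed.

Lemma braid_word_iota i x (w : seq X) : (i <= size w)%N ->
  braid_word sigma (iota 0 i) (take i.+1 (x :: w)) ++ drop i.+1 (x :: w)
  = (pull i x w).1 :: (pull i x w).2.
Proof.
elim: i x w => [|i IHi] x [|y w] //=.
move=> le_iw; have := IHi y w le_iw; rewrite (iotaDl 1 0) braid_wordS /=.
case: (braid_word _ _ _) (size_braid_word sigma (iota 0 i) (y :: take i w)) => //.
by move=> z v _ /= [<- <-]; rewrite /braid.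
Qed.

Lemma face_lE i x (w : seq X) : (i <= size w)%N ->
  face_l sigma i (x :: w) = (pull i x w).2.
Proof.
move=> le_iw; have := braid_word_iota x le_iw; rewrite /face_l.
case: (braid_word _ _ _) (size_braid_word sigma (iota 0 i) (take i.+1 (x :: w))).
  by [].
by move=> z v _ /= [].
Qed.

Lemma face_r0 x (w : seq X) : face_r sigma 0 (x :: w) = push x w.
Proof.
rewrite /face_r /= subn1 /=.
suff: exists z, braid_word sigma (rev (iota 0 (size w))) (x :: w)
              = rcons (push x w) z.
  have sz: size w = size (push x w) by elim: w x => //= y w IHw x; rewrite -IHw.
  by case=> z ->; rewrite sz -cats1 take_size_cat.
elim: w x => [|y w IHw] x /=; first by exists x.
rewrite rev_cons -cats1 braid_word_cat /= [braid _ 0 _]/braid /=.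
by rewrite (iotaDl 1 0) -map_rev braid_wordS; have [z ->] := IHw (sigma (x, y)).2; exists z.
Qed.

Lemma face_rS i x (w : seq X) : (i < size w)%N ->
  face_r sigma i.+1 (x :: w) = x :: face_r sigma i w.
Proof. by rewrite /face_r /= subSS; case: (size w). Qed.

Hypothesis sigma_braided : braided sigma.

(** The braid relation by components: [x] first crosses [y] and then [z], or [y] first crosses
    [z]. *)
Lemma ybe x y z :
  let s := sigma (x, y) in let t := sigma (s.2, z) in
  let s' := sigma (y, z) in let t' := sigma (x, s'.1) in
  [/\ (sigma (s.1, t.1)).1 = t'.1,
      (sigma (s.1, t.1)).2 = (sigma (t'.2, s'.2)).1 &
      t.2 = (sigma (t'.2, s'.2)).2].
Proof. by move: (sigma_braided (x, y, z)); rewrite /sigma12 /sigma23 /= => -[-> ->]. Qed.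

Lemma size_pull i x w : size (pull i x w).2 = size w.
Proof. by elim: i x w => [|i IHi] x [|y w] //=; rewrite IHi. Qed.

Lemma size_push x w : size (push x w) = size w.
Proof. by elim: w x => //= y w IHw x; rewrite IHw. Qed.

(** Letter [j] of [y :: w] crosses [x] either after or before [x] has crossed the other letters;
    each inductive step is one braid relation. *)
Lemma pull_push j x y w : (j <= size w)%N ->
  let v := sigma (x, y) in
  pull j v.1 (push v.2 w) =
  ((sigma (x, (pull j y w).1)).1,
   push (sigma (x, (pull j y w).1)).2 (pull j y w).2).
Proof.
elim: j x y w => [|j IHj] x y [|z w] //= le_jw.
rewrite IHj //=; have [-> -> ->] := ybe x y (pull j z w).1.
by [].
Qed.

Lemma push_face_r j x w : (j < size w)%N ->
  face_r sigma j (push x w) = push x (face_r sigma j w).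
Proof.
elim: j x w => [|j IHj] x [|y w] //= lt_jw; last first.
  by rewrite !face_rS ?size_push //= IHj.
rewrite !face_r0.
elim: w x y {lt_jw} => [|z w IHw] x y //=.
by have [-> -> ->] := ybe x y z; rewrite IHw.
Qed.

(** The supports are disjoint: pulling letter [i] of [x :: w] touches the letters up to [i], the
    right face only those from [j.+1] on. *)
Lemma pull_face_r_gt i j x w : (i <= j)%N -> (j < size w)%N ->
  pull i x (face_r sigma j w) =
  ((pull i x w).1, face_r sigma j (pull i x w).2).
Proof.
elim: i j x w => [|i IHi] [|j] x [|y w] //=; rewrite !ltnS => le_ij lt_jw.
by rewrite face_rS //= IHi //= face_rS // size_pull.
Qed.

Lemma pull_face_r_le i j x w z v : (i <= j)%N -> (j < size w)%N ->
  face_r sigma i (x :: w) = z :: v ->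
  pull j z v = ((pull j.+1 x w).1, face_r sigma i (pull j.+1 x w).2).
Proof.
elim: i j x w z v => [|i IHi] j x [|y w] z v //; rewrite [size _]/= ltnS => le_ij lt_jw.
  by rewrite face_r0 => -[<- <-]; rewrite pull_push //= face_r0.
case: j le_ij lt_jw => // j le_ij lt_jw.
rewrite face_rS; last by move=> /=; lia.
case=> <- Ev; case: v Ev => [/(congr1 size)|a v /IHi IH].
  by rewrite (size_face false) /= => sz0; rewrite sz0 in lt_jw.
rewrite /= IH //=; move: (size_pull j.+1 y w); case: (pull j.+1 y w) => b u /= szu.
by rewrite face_rS // szu; lia.
Qed.

(** The second conjunct is the face identity. The first, on the two extracted letters, strengthens
    the induction: it is what the braid relation with the head [x] requires. *)
Lemma pull_pull i j x w a z v a' z' v' : (i <= j)%N -> (j < size w)%N ->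
  pull i x w = (a, z :: v) -> pull j.+1 x w = (a', z' :: v') ->
  sigma (a, (pull j z v).1) = (a', (pull i z' v').1) /\
  (pull j z v).2 = (pull i z' v').2.
Proof.
elim: i j x w a z v a' z' v' => [|i IHi] j x [|y w] a z v a' z' v' //=.
  by move=> _ _ [-> -> ->] [<- <- <-]; case: (sigma _).
case: j => // j; rewrite !ltnS => le_ij lt_jw.
move Eb: (pull i y w) (size_pull i y w) => [b [|u0 u]] /= szb.
  by case: (w) szb lt_jw.
move Eb': (pull j.+1 y w) (size_pull j.+1 y w) => [b' [|u0' u']] //= szb'.
  by case: (w) szb' lt_jw.
move=> [<- <- <-] [<- <- <-] /=.
have [Es ->] := IHi _ _ _ _ _ _ _ _ _ le_ij lt_jw Eb Eb'.
have [] := ybe x b (pull j u0 u).1; rewrite Es => /= <- <- <-.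
by rewrite -surjective_pairing.
Qed.

(** The precubical identities. Two left or two right faces, and mixed ones whose letters cross, need
    the braid relation; otherwise the two operations have disjoint supports. *)
Lemma face_face (e o : bool) i j (w : seq X) : (i <= j)%N -> (j.+1 < size w)%N ->
  face e j (face o i w) = face o i (face e j.+1 w).
Proof.
rewrite /face; case: e o w => [] [] [|x w] //=; rewrite ?ltnS => le_ij lt_jw.
- rewrite !face_lE //; try lia.
  move Ea: (pull i x w) (size_pull i x w) => [a [|z v]] /= sza.
    by move: lt_jw; rewrite -sza.
  move Eb: (pull j.+1 x w) (size_pull j.+1 x w) => [b [|z' v']] /= szb.
    by move: lt_jw; rewrite -szb.
  rewrite !face_lE; try lia.
  by case: (pull_pull _ _ Ea Eb).
- rewrite face_lE //.
  have: size (face_r sigma i (x :: w)) = size w by rewrite (size_face false).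
  case E: (face_r sigma i (x :: w)) => [|z v] /= szv; first by move: lt_jw; rewrite -szv.
  by rewrite face_lE; [rewrite (pull_face_r_le _ _ E)|lia].
- rewrite face_lE ?face_rS //; last lia.
  rewrite face_lE ?(size_face false) //; last by move=> /=; lia.
  by rewrite pull_face_r_gt.
- elim: i j x w le_ij lt_jw => [|i IHi] j x w le_ij lt_jw.
    by rewrite face_r0 face_rS // face_r0 push_face_r.
  case: j le_ij lt_jw => // j le_ij lt_jw; case: w lt_jw => // y w lt_jw.
  have sz o k : size (face_r sigma k (o :: w)) = size w by rewrite (size_face false).
  rewrite /= in lt_jw.
  rewrite (face_rS x (w := y :: w) (i := i)) ?(face_rS x (w := y :: w) (i := j.+1)) /=; try lia.
  by rewrite !(face_rS x) ?sz ?IHi //; lia.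
Qed.

End Faces.
Arguments face : simpl never.

(* None is a free direction, Some true the side l and Some false the side r.   *)
Notation code := (option bool).

Fixpoint stars (c : seq code) : nat :=
  match c with
  | [::] => 0
  | Some _ :: c' => stars c'
  | None :: c' => (stars c').+1
  end.

Lemma stars_size c : (stars c <= size c)%N.
Proof. by elim: c => [|[o|] c IHc] //=; apply: leqW. Qed.

Definition ins (T : Type) (m : nat) (x : T) (c : seq T) : seq T :=
  take m c ++ x :: drop m c.

(* The differential of the cube, with the functional h on faces as argument.   *)
Fixpoint codiff (K : comPzRingType) (h : seq code -> K) (c : seq code) : K :=
  match c with
  | [::] => 0
  | Some o :: c' => codiff (fun v => h (Some o :: v)) c'
  | None :: c' => h (Some true :: c') - h (Some false :: c')
                  - codiff (fun v => h (None :: v)) c'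
  end.

Section Multiface.

Variables (X : Type) (sigma : X * X -> X * X).

(* Deleting the largest index first, all other indices keep their meaning; i   *)
(* is the index of the head of c.                                              *)
Fixpoint multiface (i : nat) (c : seq code) (w : seq X) : seq X :=
  match c with
  | [::] => w
  | Some o :: c' => face sigma o i (multiface i.+1 c' w)
  | None :: c' => multiface i.+1 c' w
  end.

Lemma size_multiface i c w :
  size (multiface i c w) = (size w - (size c - stars c))%N.
Proof.
elim: c i => [|[o|] c IHc] i //=.
- by rewrite sub0n subn0.
- by rewrite size_face IHc; have := stars_size c; lia.
Qed.

Hypothesis sigma_braided : braided sigma.

Lemma multiface_face_lt o i j c w : (i <= j)%N -> (j + size c < size w)%N ->
  multiface j c (face sigma o i w) = face sigma o i (multiface j.+1 c w).
Proof.
elim: c j => [|[o'|] c IHc] j //= le_ij lt_jw; rewrite IHc //; try lia.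
by rewrite face_face // size_multiface; lia.
Qed.

(** A face of a face of [w] is a face of [w]: the precubical identities carry the deletion of
    [i + m] past those of smaller indices. *)
Lemma multiface_face o i m c w : (m <= size c)%N -> (i + size c < size w)%N ->
  multiface i c (face sigma o (i + m) w) = multiface i (ins m (Some o) c) w.
Proof.
elim: m i c => [|m IHm] i c le_mc lt_iw.
  by rewrite /ins addn0 take0 drop0 multiface_face_lt.
case: c le_mc lt_iw => //= x c le_mc lt_iw.
by case: x => [o'|]; rewrite -IHm ?addnS ?addSn //; lia.
Qed.

(** Letter [i + m] of the word [multiface i c w] comes from the [m]-th star of [c], and its deletion
    turns this star into a side. *)
Lemma codiff_multiface (K : comPzRingType) (h : seq X -> K) i c w :
  size w = (i + size c)%N ->
  \sum_(m < stars c) (-1) ^+ m * (h (face sigma true (i + m) (multiface i c w))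
                              - h (face sigma false (i + m) (multiface i c w)))
  = codiff (fun v => h (multiface i v w)) c.
Proof.
elim: c i h => [|[o|] c IHc] i h szw.
- by rewrite big_ord0.
- rewrite /= in szw *; have /= <- := IHc i.+1 (fun v => h (face sigma o i v));
    last by rewrite szw addnS.
  apply: eq_bigr => m _ /=; have lt_m := ltn_ord m.
  have szv : ((i + m).+1 < size (multiface i.+1 c w))%N.
    by rewrite size_multiface szw; have := stars_size c; lia.
  by rewrite (face_face sigma_braided true) ?(face_face sigma_braided false) ?leq_addr.
rewrite big_ord_recl expr0 mul1r addn0 /=.
have /= <- := IHc i.+1 h; last by rewrite szw addnS.
by rewrite -sumrN; congr (_ + _); apply: eq_bigr => m _; rewrite exprS addnS /= mulN1r mulNr.
Qed.

End Multiface.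

Notation letter := (code * code)%type.

(** * The telescoping identity *)

Section Formal.

Variable K : comPzRingType.
Implicit Type phi : seq letter -> K.

Notation l := (Some true).
Notation r := (Some false).

(* A formal sum of letters acts on functionals by plugging it in as the first  *)
(* letter.                                                                     *)
Definition opa phi u : K := - phi ((None, l) :: u) - phi ((r, None) :: u).
Definition opb phi u : K := phi ((l, None) :: u) + phi ((None, r) :: u).
Definition opc phi u : K := phi ((None, None) :: u).
Definition ope phi u : K := phi ((l, l) :: u) - phi ((r, r) :: u).

(* The values of phi at a^n, b^n and the sum of the words a^i c b^j.           *)
Fixpoint evalA n phi : K := if n is n'.+1 then evalA n' (opa phi) else phi [::].
Fixpoint evalB n phi : K := if n is n'.+1 then evalB n' (opb phi) else phi [::].
Fixpoint evalS n phi : K :=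
  if n is n'.+1 then evalS n' (opa phi) + evalB n' (opc phi) else 0.

Definition dletter1 (x : code) (h : code -> K) : K :=
  if x is None then h l - h r else 0.

(** The transpose of the graded derivation D; the degree of a letter is the number of its stars. *)
Fixpoint fdiff phi (u : seq letter) : K :=
  if u is x :: u' then
    dletter1 x.1 (fun y => phi ((y, x.2) :: u'))
    + (-1) ^+ (x.1 == None) * dletter1 x.2 (fun y => phi ((x.1, y) :: u'))
    + (-1) ^+ ((x.1 == None) + (x.2 == None)) * fdiff (fun v => phi (x :: v)) u'
  else 0.

(* The signed sums of all insertions of e into b^n and into the words          *)
(* a^i c b^j.                                                                  *)
Fixpoint insB n phi : K :=
  evalB n (ope phi) - (if n is n'.+1 then insB n' (opb phi) else 0).
Fixpoint insS n phi : K :=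
  evalS n (ope phi) -
  (if n is n'.+1 then insS n' (opa phi) + insB n' (opc phi) else 0).

Lemma eq_evalB n phi psi : (forall u, size u = n -> phi u = psi u) ->
  evalB n phi = evalB n psi.
Proof.
elim: n phi psi => [|n IHn] phi psi E /=; first exact: E.
by apply: IHn => u szu; rewrite /opb !E //= szu.
Qed.

Lemma eq_evalS n phi psi : (forall u, size u = n -> phi u = psi u) ->
  evalS n phi = evalS n psi.
Proof.
elim: n phi psi => //= n IHn phi psi E; congr (_ + _).
  by apply: IHn => u szu; rewrite /opa !E //= szu.
by apply: eq_evalB => u szu; rewrite /opc E //= szu.
Qed.

Lemma eq_fdiff phi psi u : phi =1 psi -> fdiff phi u = fdiff psi u.
Proof.
elim: u phi psi => //= -[x y] u IHu phi psi E; congr (_ + _ + _ * _).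
- by case: x => //=; rewrite !E.
- by case: y => //=; rewrite !E.
by apply: IHu => v; apply: E.
Qed.

Section Linear.

Variables (k1 k2 : K) (phi psi : seq letter -> K).
Let lin phi psi := fun u : seq letter => k1 * phi u + k2 * psi u.

Lemma evalB_lin n : evalB n (lin phi psi) = k1 * evalB n phi + k2 * evalB n psi.
Proof.
elim: n phi psi => //= n IHn phi' psi'; rewrite -IHn; apply: eq_evalB => u _.
by rewrite /opb /lin; ring.
Qed.

Lemma fdiff_lin u : fdiff (lin phi psi) u = k1 * fdiff phi u + k2 * fdiff psi u.
Proof.
elim: u phi psi => /= [|[x y] u IHu] phi' psi' /=; first by ring.
by rewrite [fdiff _ u]IHu; case: x; case: y => * /=; rewrite /lin; ring.
Qed.

End Linear.

Lemma evalS_lin (k1 k2 : K) phi psi n :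
  evalS n (fun u => k1 * phi u + k2 * psi u) = k1 * evalS n phi + k2 * evalS n psi.
Proof.
elim: n phi psi => [|n IHn] phi psi /=; first by ring.
rewrite [evalB _ _]evalB_lin.
rewrite (_ : evalS n _ = k1 * evalS n (opa phi) + k2 * evalS n (opa psi)); first by ring.
by rewrite -IHn; apply: eq_evalS => u _; rewrite /opa; ring.
Qed.

(** Here and in the next two lemmas: D(a u) = - e u - a D u, D(b u) = e u - b D u and D(c u) = (a +
    b) u + c D u. The explicit coefficients fit [evalB_lin] and [evalS_lin]. *)
Lemma opa_fdiff phi u :
  opa (fdiff phi) u = (-1) * fdiff (opa phi) u + (-1) * ope phi u.
Proof.
rewrite (eq_fdiff u (psi := fun v => (-1) * phi ((None, l) :: v) + (-1) * phi ((r, None) :: v))).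
  by rewrite fdiff_lin /opa /ope /=; ring.
by move=> v; rewrite /opa; ring.
Qed.

Lemma opb_fdiff phi u :
  opb (fdiff phi) u = (-1) * fdiff (opb phi) u + 1 * ope phi u.
Proof.
rewrite (eq_fdiff u (psi := fun v => 1 * phi ((l, None) :: v) + 1 * phi ((None, r) :: v))).
  by rewrite fdiff_lin /opb /ope /=; ring.
by move=> v; rewrite /opb; ring.
Qed.

Lemma opc_fdiff phi u :
  opc (fdiff phi) u = 1 * fdiff (opc phi) u + 1 * (1 * opa phi u + 1 * opb phi u).
Proof. by rewrite /opc /opa /opb /=; ring. Qed.

Lemma evalB_fdiff n phi :
  evalB n (fdiff phi) = if n is n'.+1 then insB n' phi else 0.
Proof.
elim: n phi => //= n IHn phi.
rewrite (eq_evalB (fun u _ => opb_fdiff phi u)) evalB_lin IHn.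
by case: n {IHn} => [|n] /=; ring.
Qed.

(** Up to words with e, D S_{n+1} = - a D S_n + (a + b) b^n; by induction the terms a b^n cancel and
    b^{n+1} + (-1)^n a^{n+1} remains. *)
Lemma evalS_fdiff n phi :
  evalS n (fdiff phi) + (if n is n'.+1 then insS n' phi else 0)
  = evalB n phi - (-1) ^+ n * evalA n phi.
Proof.
elim: n phi => [|n IHn] phi /=; first by ring.
rewrite (eq_evalS (fun u _ => opa_fdiff phi u)) evalS_lin.
rewrite (eq_evalB (fun u _ => opc_fdiff phi u)) !evalB_lin evalB_fdiff exprS.
have := IHn (opa phi); set x := (X in _ + X = _) => IH.
have -> : evalS n (fdiff (opa phi)) = evalB n (opa phi) - (-1) ^+ n * evalA n (opa phi) - x.
  by rewrite -IH addrK.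
by rewrite /x; case: n {IHn x IH} => [|n] /=; ring.
Qed.

Lemma insB_sum n phi :
  insB n phi = \sum_(m < n.+1) (-1) ^+ m *
    evalB n (fun u => phi (ins m (l, l) u) - phi (ins m (r, r) u)).
Proof.
elim: n phi => [|n IHn] phi; first by rewrite /= big_ord1 /ope /ins /= subr0 mul1r.
rewrite big_ord_recl mul1r [insB _ _]/= IHn -sumrN; congr (_ + _).
apply: eq_bigr => m _; rewrite exprS mulN1r mulNr; congr (- (_ * _)).
by apply: eq_evalB => u _; rewrite /opb /ins /=; ring.
Qed.

Lemma insS_sum n phi :
  insS n phi = \sum_(m < n.+1) (-1) ^+ m *
    evalS n (fun u => phi (ins m (l, l) u) - phi (ins m (r, r) u)).
Proof.
elim: n phi => [|n IHn] phi; first by rewrite /= big_ord1 mulr0 subr0.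
rewrite big_ord_recl mul1r [insS _ _]/= IHn insB_sum -big_split -sumrN; congr (_ + _).
apply: eq_bigr => m _; rewrite exprS mulN1r mulNr -[LHS]/(- (_ + _)) -mulrDr; congr (- (_ * _)).
by congr (_ + _); apply: eq_evalS => u _; rewrite /opa /ins /=; ring.
Qed.

(* The exponent of the Koszul sign: free directions of g before ones of f.     *)
Fixpoint kappa (u : seq letter) : nat :=
  if u is x :: u' then ((x.2 == None) * stars (unzip1 u') + kappa u')%N else 0%N.

Definition psi (f g : seq code -> K) (u : seq letter) : K :=
  (-1) ^+ kappa u * (f (unzip1 u) * g (unzip2 u)).

Lemma eq_codiff (f g : seq code -> K) c : f =1 g -> codiff f c = codiff g c.
Proof.
elim: c f g => [|[o|] c IHc] f g E //=; first by apply: IHc => v; rewrite E.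
by rewrite !E; congr (_ - _); apply: IHc => v; rewrite E.
Qed.

Lemma codiffZ (k : K) f c : codiff (fun v => k * f v) c = k * codiff f c.
Proof. by elim: c f => [|[o|] c IHc] f /=; rewrite ?IHc; ring. Qed.

(** The differential evaluates its functional at codes with one star less than [c]. *)
Lemma codiff_sign (b : bool) (f : seq code -> K) c :
  codiff (fun v => (-1) ^+ (b * stars v) * f v) c
  = (-1) ^+ b * (-1) ^+ (b * stars c) * codiff f c.
Proof.
case: b => /=; last first.
  by rewrite (eq_codiff c (g := f)) => [|v]; rewrite mul0n !mul1r.
rewrite (eq_codiff c (g := fun v => (-1) ^+ stars v * f v)) => [|v]; rewrite ?mul1n //.
elim: c f => [|[o|] c IHc] f /=; rewrite ?IHc; try by ring.
rewrite (eq_codiff c (g := fun v => (-1) * ((-1) ^+ stars v * f (None :: v)))).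
  by rewrite codiffZ IHc !exprS expr0; ring.
by move=> v; rewrite exprS /=; ring.
Qed.

Lemma signrP n : (-1 : K) ^+ n = 1 \/ (-1 : K) ^+ n = -1.
Proof. by rewrite -signr_odd; case: (odd n); [right|left]. Qed.

(** The Leibniz rule: [kappa] is the sign of the shuffle that sorts the interleaved stars into those
    of [f] followed by those of [g]. *)
Lemma fdiff_psi f g u :
  fdiff (psi f g) u
  = psi (codiff f) g u + psi (fun c => (-1) ^+ stars c * f c) (codiff g) u.
Proof.
elim: u f g => [|[x y] u IHu] f g; first by rewrite /psi /=; ring.
(* With its head letter fixed, [psi f g] is again of the form [psi]; the Koszul sign of a star [y]
   is absorbed into [f]. *)
rewrite [LHS]/= (@eq_fdiff _
  (psi (fun c => (-1) ^+ ((y == None) * stars c) * f (x :: c)) (fun c => g (y :: c)))); last first.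
  by move=> v; rewrite /psi /= exprD; ring.
rewrite IHu {IHu}.
rewrite /psi /= codiff_sign exprD.
case: y => [b'|]; case: x => [b|]; rewrite /= ?mul0n ?mul1n ?exprS ?exprD;
  have [->|->] := signrP (stars (unzip1 u)); by ring.
Qed.

End Formal.

(** * Cochains as functionals on faces *)

(* Extension by zero makes the conditions on the cardinals of the index sets    *)
(* automatic.                                                                  *)
Definition ext (X : Type) (K : comPzRingType) (p : nat) (f : cochain X K p)
  (s : seq X) : K := if insub s is Some v then f v else 0.

Section Words.

Variables (X : Type) (sigma : X * X -> X * X) (K : comPzRingType).

Lemma ext_tuple p (f : cochain X K p) (v : p.-tuple X) : ext f v = f v.
Proof. by rewrite /ext valK. Qed.

Lemma ext_size p (f : cochain X K p) s : size s != p -> ext f s = 0.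
Proof. by move=> Hs; rewrite /ext insubN. Qed.

Lemma ext_diff p (f : cochain X K p) s :
  ext (diff sigma (k := p.+1) f) s
  = \sum_(i < size s) (-1) ^+ i * (ext f (face sigma true i s) - ext f (face sigma false i s)).
Proof.
have [Hs | Hs] := eqVneq (size s) p.+1; last first.
  rewrite ext_size // big1 // => -[i lt_is] _ /=.
  have ne_p o : size (face sigma o i s) != p.
    by rewrite size_face; case: (size s) Hs lt_is.
  by rewrite !ext_size ?subr0 ?mulr0.
have {Hs} [t ->] : exists t : p.+1.-tuple X, s = t by exists (Tuple (introT eqP Hs)).
rewrite ext_tuple size_tuple; apply: eq_bigr => i _.
by rewrite /d_l /d_r -!(ext_tuple f).
Qed.

Definition Psi p q (f : cochain X K p) (g : cochain X K q) (w : seq X) :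
  seq letter -> K :=
  psi (fun c => ext f (multiface sigma 0 c w)) (fun c => ext g (multiface sigma 0 c w)).

Section PsiIdentities.

Hypothesis sigma_braided : braided sigma.

Variables (p q : nat) (f : cochain X K p) (g : cochain X K q).

Lemma unzip1_ins m (x : letter) u : unzip1 (ins m x u) = ins m x.1 (unzip1 u).
Proof. by rewrite /ins /unzip1 map_cat /= map_take map_drop. Qed.

Lemma unzip2_ins m (x : letter) u : unzip2 (ins m x u) = ins m x.2 (unzip2 u).
Proof. by rewrite /ins /unzip2 map_cat /= map_take map_drop. Qed.

Lemma stars_ins m o c : stars (ins m (Some o) c) = stars c.
Proof. by elim: m c => [|m IHm] [|[o'|] c] //; rewrite /ins /= -/(ins _ _ _) IHm. Qed.

Lemma kappa_ins m o o' u : kappa (ins m (Some o, Some o') u) = kappa u.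
Proof.
elim: m u => [|m IHm] [|x u] //; rewrite [LHS]/= -/(ins _ _ _) IHm.
by rewrite unzip1_ins stars_ins.
Qed.

(** The letter deletes index [m] for both factors and, having no star, does not affect the Koszul
    sign. *)
Lemma Psi_ins o m (w : seq X) u : (m <= size u)%N -> (size u < size w)%N ->
  Psi f g w (ins m (Some o, Some o) u) = Psi f g (face sigma o m w) u.
Proof.
move=> le_mu lt_uw; rewrite /Psi /psi kappa_ins unzip1_ins unzip2_ins.
by rewrite -!multiface_face ?size_map.
Qed.

Lemma insS_Psi n (w : seq X) : size w = n.+1 ->
  insS n (Psi f g w) = \sum_(m < n.+1) (-1) ^+ m *
    (evalS n (Psi f g (face sigma true m w)) - evalS n (Psi f g (face sigma false m w))).
Proof.
move=> szw; rewrite insS_sum; apply: eq_bigr => m _; congr (_ * _).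
rewrite -[X in X - _]mul1r -[- evalS _ _]mulN1r -evalS_lin.
apply: eq_evalS => u szu; rewrite mul1r mulN1r !Psi_ins ?szw ?szu //; exact: ltn_ord m.
Qed.

Lemma codiff_ext n (h : cochain X K n) c (w : seq X) : size c = size w ->
  codiff (fun v => ext h (multiface sigma 0 v w)) c
  = ext (diff sigma (k := n.+1) h) (multiface sigma 0 c w).
Proof.
move=> szc; rewrite -codiff_multiface ?szc // ext_diff size_multiface.
by rewrite -szc subKn // stars_size.
Qed.

(** The face has [stars c] letters, so both sides vanish unless [stars c] equals [n]. *)
Lemma ext_stars n (h : cochain X K n) c (w : seq X) : size c = size w ->
  (-1) ^+ stars c * ext h (multiface sigma 0 c w)
  = (-1) ^+ n * ext h (multiface sigma 0 c w).
Proof.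
move=> szc; have [-> //| ne_n] := eqVneq (stars c) n.
by rewrite ext_size ?mulr0 // size_multiface -szc subKn // stars_size.
Qed.

End PsiIdentities.

Lemma fdiff_Psi (sigma_braided : braided sigma) p q (f : cochain X K p)
  (g : cochain X K q) (w : seq X) u : size u = size w ->
  fdiff (Psi f g w) u
  = 1 * Psi (diff sigma (k := p.+1) f) g w u
    + (-1) ^+ p * Psi f (diff sigma (k := q.+1) g) w u.
Proof.
move=> szu; rewrite fdiff_psi mul1r /Psi /psi; congr (_ + _).
  by rewrite codiff_ext // size_map.
by rewrite codiff_ext ?ext_stars ?size_map // -mulrA mulrCA.
Qed.

End Words.

(** * Cup products *)

Section BraidWords.

Variables (X : Type) (sigma : X * X -> X * X).

Lemma braid_catl i (v w : seq X) : (i.+1 < size v)%N ->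
  braid sigma i (v ++ w) = braid sigma i v ++ w.
Proof.
rewrite /braid => lt_iv; rewrite takel_cat ?drop_cat ?(ltnW (ltnW lt_iv)) // ltnW //.
rewrite -catA; congr (_ ++ _).
by case: (drop i v) (size_drop i v) => [|x [|y v']] //= sz; lia.
Qed.

Lemma braid_word_catl u (v w : seq X) : all (fun i => (i.+1 < size v)%N) u ->
  braid_word sigma u (v ++ w) = braid_word sigma u v ++ w.
Proof.
elim: u => //= i u IHu /andP[lt_iv /IHu ->].
by rewrite braid_catl ?size_braid_word.
Qed.

Lemma braid_word_catr u (v w : seq X) :
  braid_word sigma (map (addn (size v)) u) (v ++ w) = v ++ braid_word sigma u w.
Proof.
elim: v => [|x v IHv]; first by rewrite (eq_map add0n) map_id.
by rewrite /= -IHv -braid_wordS -map_comp.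
Qed.

Lemma face_l_braid_word i (w : seq X) : (i < size w)%N ->
  face_l sigma i w = behead (braid_word sigma (iota 0 i) w).
Proof.
move=> lt_iw; rewrite -{2}(cat_take_drop i.+1 w) braid_word_catl.
  have := size_braid_word sigma (iota 0 i) (take i.+1 w).
  by rewrite /face_l size_takel //; case: (braid_word _ _ _).
by apply/allP => j; rewrite mem_iota size_takel //.
Qed.

Lemma face_r_braid_word i (w : seq X) : (i < size w)%N ->
  face_r sigma i w
  = take (size w).-1 (braid_word sigma (rev (iota i (size w - i.+1))) w).
Proof.
move=> lt_iw; have szt := size_takel (ltnW lt_iw).
rewrite -[X in braid_word _ _ X](cat_take_drop i w) -[X in iota X _]addn0 iotaDl.
by rewrite -map_rev -[X in addn X]szt braid_word_catr.
Qed.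

(** Moving letter [i.+1] to the front begins with the exchange at [i]. Symmetrically, moving letter
    [i] to the end does so in [face_r_braid]. *)
Lemma face_l_braid i (w : seq X) : (i.+1 < size w)%N ->
  face sigma true i (braid sigma i w) = face sigma true i.+1 w.
Proof.
move=> lt_iw; rewrite /face !face_l_braid_word ?size_braid //; last exact: ltnW.
by rewrite -addn1 iotaD braid_word_cat.
Qed.

Lemma face_r_braid i (w : seq X) : (i.+1 < size w)%N ->
  face sigma false i.+1 (braid sigma i w) = face sigma false i w.
Proof.
move=> lt_iw; rewrite /face !face_r_braid_word ?size_braid //; last exact: ltnW.
by rewrite -[in RHS](subnSK lt_iw) [iota i _]/= rev_cons -cats1 braid_word_cat.
Qed.

End BraidWords.

(* true marks the letters that have to move to the front.                      *)
Fixpoint inversions (c : seq bool) : nat :=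
  if c is b :: c' then (~~ b * count id c' + inversions c')%N else 0.

Definition flip (T : Type) (xy : T * T) : T * T := (xy.2, xy.1).

Definition sorted_form (c : seq bool) : seq bool :=
  nseq (count id c) true ++ nseq (count negb c) false.

Lemma inversions_cat c d :
  inversions (c ++ d) = (inversions c + inversions d + count negb c * count id d)%N.
Proof. by elim: c => [|[] c IHc] /=; rewrite ?IHc ?count_cat; lia. Qed.

Lemma inversions_sorted_form c : inversions (sorted_form c) = 0%N.
Proof.
rewrite /sorted_form; elim: (count id c) => //=.
by elim: (count negb c) => //= n ->; rewrite count_nseq.
Qed.

Lemma count_braid (a : pred bool) i c : count a (braid (@flip bool) i c) = count a c.
Proof.
rewrite -[in RHS](cat_take_drop i c) /braid !count_cat; congr (_ + _)%N.
by case: (drop i c) => [|x [|y v]] //=; lia.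
Qed.

(** Only the exchange of a neighbouring pair in the wrong order lowers [inversions]. [InvBraidUp]
    includes the indices at which [braid] is the identity for lack of letters. *)
Variant inversions_braid_spec i c : Prop :=
  | InvBraidDown c1 c2 of i = size c1 & c = c1 ++ [:: false, true & c2] &
      braid (@flip bool) i c = c1 ++ [:: true, false & c2]
  | InvBraidUp of (inversions c <= inversions (braid (@flip bool) i c))%N.

Lemma inversions_braidP i c : inversions_braid_spec i c.
Proof.
have E := cat_take_drop i c.
case D: (drop i c) => [|x [|y v]].
- by right; rewrite /braid D cats0 -{1}E D cats0.
- by right; rewrite /braid D -{1}E D.
have sz : size (take i c) = i.
  by rewrite size_takel //; move: (congr1 size D); rewrite size_drop /=; lia.
case: x y D => [] [] D.
1,2,4: by right; rewrite /braid D -{1}E D !inversions_cat /=; lia.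
by left with (take i c) v => //; [rewrite -{1}E D | rewrite /braid D].
Qed.

Lemma inversions_le_size u c :
  braid_word (@flip bool) u c = sorted_form c -> (inversions c <= size u)%N.
Proof.
elim/last_ind: u c => [|u i IHu] c /=.
  by move=> /(congr1 inversions); rewrite inversions_sorted_form => ->.
rewrite -cats1 braid_word_cat /= => Eu.
have := IHu (braid (@flip bool) i c); rewrite /sorted_form !count_braid => /(_ Eu).
rewrite cats1 size_rcons; case: (inversions_braidP i c) => [c1 c2 _ -> ->|]; last by lia.
by rewrite !inversions_cat /=; lia.
Qed.

(** In a cup product the marked letters go to [f]: its face moves the unmarked ones out to the
    right, while the face for [g] moves the marked ones out to the left. *)
Definition codeF (b : bool) : code := if b then None else Some false.
Definition codeG (b : bool) : code := if b then Some true else None.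

Lemma count_negb c : (count negb c = size c - count id c)%N.
Proof. by rewrite -(count_predC id c) addKn; apply: eq_count. Qed.

Lemma stars_codeF c : stars (map codeF c) = count id c.
Proof. by elim: c => [|[] c IHc] //=; rewrite IHc. Qed.

Lemma stars_codeG c : stars (map codeG c) = count negb c.
Proof. by elim: c => [|[] c IHc] //=; rewrite IHc. Qed.

Section SortingWords.

Variables (X : Type) (sigma : X * X -> X * X).
Hypothesis sigma_braided : braided sigma.

Lemma multiface_swapF c1 c2 w : size w = (size c1 + size c2).+2 ->
  multiface sigma 0 (map codeF (c1 ++ [:: true, false & c2])) (braid sigma (size c1) w)
  = multiface sigma 0 (map codeF (c1 ++ [:: false, true & c2])) w.
Proof.
move=> szw; rewrite !map_cat /=.
(* The code common to both sides once the deleted letter of the exchanged pair is omitted. *)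
pose d := map codeF c1 ++ None :: map codeF c2.
have szd : size d = (size c1 + size c2).+1 by rewrite size_cat /= !size_map addnS.
have -> : map codeF c1 ++ [:: None, Some false & map codeF c2] = ins (size c1).+1 (Some false) d.
  rewrite /ins /d take_cat drop_cat size_map ltnNge leqnSn /= subSnn /= take0 drop0.
  by rewrite -catA.
have -> : map codeF c1 ++ [:: Some false, None & map codeF c2] = ins (size c1) (Some false) d.
  by rewrite /ins /d take_size_cat ?drop_size_cat ?size_map.
rewrite -!multiface_face ?size_braid ?szd ?szw //; try lia.
by rewrite !add0n face_r_braid // szw; lia.
Qed.

Lemma multiface_swapG c1 c2 w : size w = (size c1 + size c2).+2 ->
  multiface sigma 0 (map codeG (c1 ++ [:: true, false & c2])) (braid sigma (size c1) w)
  = multiface sigma 0 (map codeG (c1 ++ [:: false, true & c2])) w.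
Proof.
move=> szw; rewrite !map_cat /=.
pose d := map codeG c1 ++ None :: map codeG c2.
have szd : size d = (size c1 + size c2).+1 by rewrite size_cat /= !size_map addnS.
have -> : map codeG c1 ++ [:: None, Some true & map codeG c2] = ins (size c1).+1 (Some true) d.
  rewrite /ins /d take_cat drop_cat size_map ltnNge leqnSn /= subSnn /= take0 drop0.
  by rewrite -catA.
have -> : map codeG c1 ++ [:: Some true, None & map codeG c2] = ins (size c1) (Some true) d.
  by rewrite /ins /d take_size_cat ?drop_size_cat ?size_map.
rewrite -!multiface_face ?size_braid ?szd ?szw //; try lia.
by rewrite !add0n face_l_braid // szw; lia.
Qed.

Lemma multiface_nseq_None i a d w :
  multiface sigma i (nseq a None ++ d) w = multiface sigma (i + a) d w.
Proof. by elim: a i => [|a IHa] i /=; rewrite ?addn0 // IHa addSnnS. Qed.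

Lemma multiface_nseq_r i b w : size w = (i + b)%N ->
  multiface sigma i (nseq b (Some false)) w = take i w.
Proof.
elim: b i => [|b IHb] i szw /=; first by rewrite take_oversize // szw addn0.
rewrite IHb ?szw ?addSnnS // /face.
have szt : size (take i.+1 w) = i.+1 by rewrite size_takel // szw; lia.
by rewrite face_r_braid_word szt // subnn /= -take_min (minn_idPl _).
Qed.

Lemma multiface_nseq_l a d w : size w = (a + size d)%N ->
  multiface sigma 0 (nseq a (Some true) ++ d) w = multiface sigma 0 d (drop a w).
Proof.
elim: a w => [|a IHa] w szw; first by rewrite drop0.
have -> : nseq a.+1 (Some true) ++ d = ins 0 (Some true) (nseq a (Some true) ++ d).
  by rewrite /ins take0 drop0.
rewrite -multiface_face ?size_cat ?size_nseq ?szw // /face face_l_braid_word ?szw //.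
by rewrite IHa ?size_behead ?szw //= -drop1 drop_drop addn1.
Qed.

(* A word that sorts c in as few steps as possible only exchanges neighbours   *)
(* that are out of order.                                                      *)
Lemma braid_word_multiface u c w : size w = size c ->
  braid_word (@flip bool) u c = sorted_form c -> (size u <= inversions c)%N ->
  braid_word sigma u w
  = multiface sigma 0 (map codeF c) w ++ multiface sigma 0 (map codeG c) w.
Proof.
elim/last_ind: u c w => [|u i IHu] c w szw.
  move=> /= Ec _; rewrite Ec /sorted_form !map_cat !map_nseq /=.
  have szc : size w = (count id c + count negb c)%N by rewrite szw -(count_predC id c).
  rewrite multiface_nseq_None multiface_nseq_r // multiface_nseq_l ?size_nseq //.
  by rewrite -[nseq _ None]cats0 multiface_nseq_None cat_take_drop.
rewrite -cats1 !braid_word_cat /= cats1 size_rcons => Eu le_uc.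
have Eu' : braid_word (@flip bool) u (braid (@flip bool) i c)
            = sorted_form (braid (@flip bool) i c).
  by rewrite /sorted_form !count_braid.
(* Together with [le_uc], this forces the exchange at [i] to lower [inversions], which excludes
   [InvBraidUp]. *)
have le_inv := inversions_le_size Eu'.
case: (inversions_braidP i c) => [c1 c2 Ei Ec Eb|]; last by lia.
rewrite (IHu (braid (@flip bool) i c)) ?size_braid //.
  rewrite Eb Ec Ei multiface_swapF ?multiface_swapG // szw Ec size_cat /=; lia.
by move: le_uc; rewrite Eb Ec !inversions_cat /=; lia.
Qed.

End SortingWords.

(** Insertion sort: the tail is sorted first, then an unmarked head crosses all marked letters. *)
Fixpoint sorting_word (c : seq bool) : seq nat :=
  match c with
  | [::] => [::]
  | true :: c' => map S (sorting_word c')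
  | false :: c' => rev (iota 0 (count id c')) ++ map S (sorting_word c')
  end.

Lemma size_sorting_word c : size (sorting_word c) = inversions c.
Proof.
elim: c => [|[] c IHc] //=; first by rewrite size_map IHc.
by rewrite size_cat size_rev size_iota size_map IHc mul1n.
Qed.

Lemma sorting_word_lt c : all (fun i => (i.+1 < size c)%N) (sorting_word c).
Proof.
elim: c => [|[] c IHc] //=; rewrite ?all_cat ?all_map ?(sub_all _ IHc) // andbT.
apply/allP => i; rewrite mem_rev mem_iota /= add0n ltnS => lt_ic.
by apply: leq_trans lt_ic (count_size _ _).
Qed.

Lemma braid_word_rev_iota (T : Type) (x : T) (v w : seq T) :
  braid_word (@flip T) (rev (iota 0 (size v))) (x :: v ++ w) = v ++ x :: w.
Proof.
elim: v => //= y v IHv; rewrite rev_cons -cats1 braid_word_cat /= [braid _ 0 _]/braid /=.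
by rewrite (iotaDl 1 0) -map_rev braid_wordS IHv.
Qed.

Lemma braid_word_sorting_word (T : Type) c (w : seq T) : size w = size c ->
  braid_word (@flip T) (sorting_word c) w = mask c w ++ mask (map negb c) w.
Proof.
elim: c w => [|[] c IHc] [|x w] //= [szw]; first by rewrite braid_wordS IHc.
rewrite braid_word_cat braid_wordS IHc // -(size_mask (esym szw)).
by rewrite braid_word_rev_iota.
Qed.

Lemma sorted_formE c : mask c c ++ mask (map negb c) c = sorted_form c.
Proof.
rewrite /sorted_form; congr (_ ++ _).
  by elim: c => [|[] c IHc] //=; rewrite IHc.
by elim: c => [|[] c IHc] //=; rewrite IHc.
Qed.

(** * Permutations and shuffles *)

Section PermAction.

Variable n : nat.

Lemma nth_braid (T : Type) (x0 : T) i w j : (i.+1 < size w)%N ->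
  nth x0 (braid (@flip T) i w) j
  = nth x0 w (if j == i then i.+1 else if j == i.+1 then i else j).
Proof.
elim: i w j => [|i IHi] [|x [|y w]] // j lt_iw; first by case: j => [|[]].
rewrite -[braid _ _ _]/(x :: braid (@flip T) i (y :: w)).
by case: j => [|j] //=; rewrite IHi // !eqSS; case: eqP => //; case: eqP.
Qed.

Lemma braid_enum (T : Type) (h : 'I_n -> T) (a : 'I_n.-1) :
  braid (@flip T) a [seq h i | i <- enum 'I_n] = [seq h (adj a i) | i <- enum 'I_n].
Proof.
have i0 : 'I_n := Ordinal (adj_subproof1 a).
apply: (@eq_from_nth _ (h i0)); first by rewrite size_braid !size_map.
move=> j; rewrite size_braid size_map size_enum_ord => lt_jn.
rewrite nth_braid ?size_map ?size_enum_ord ?adj_subproof2 //.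
rewrite [RHS](nth_map i0) ?size_enum_ord //.
rewrite (nth_map i0) ?size_enum_ord; last first.
  by case: ifP => _; [exact: adj_subproof2|case: ifP => // _; exact: adj_subproof1].
congr h; apply: val_inj => /=.
rewrite nth_enum_ord; last first.
  by case: ifP => _; [exact: adj_subproof2|case: ifP => // _; exact: adj_subproof1].
have -> : nth i0 (enum 'I_n) j = Ordinal lt_jn by apply: val_inj; rewrite /= nth_enum_ord.
by rewrite /adj; case: tpermP => [[->]|[->]|]; rewrite ?eqxx //= ?(gtn_eqF (ltnSn _)) //
 => /eqP; rewrite -val_eqE /= => /negPf-> /eqP; rewrite -val_eqE /= => /negPf->.
by rewrite -enumT size_enum_ord adj_subproof2.
Qed.

(** The flip acts on positions, hence the inverse permutation on the argument of [h]. *)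
Lemma braid_word_enum (T : Type) (h : 'I_n -> T) (u : seq 'I_n.-1) :
  braid_word (@flip T) (map val u) [seq h i | i <- enum 'I_n]
  = [seq h ((perm_of_word u)^-1%g i) | i <- enum 'I_n].
Proof.
elim: u => [|a u IHu] /=.
  by apply: eq_map => i; rewrite /perm_of_word big_nil invg1 perm1.
rewrite IHu braid_enum; apply: eq_map => i.
rewrite -cat1s perm_of_word_cat perm_of_word1 invMg permM.
by rewrite /adj tpermV.
Qed.

(** The signs of the cup product depend only on the parity of a length, which any expression of the
    permutation computes. *)
Lemma odd_perm_of_word (u : seq 'I_n.-1) : perm_of_word u = odd (size u) :> bool.
Proof.
elim: u => [|a u IHu]; first by rewrite /perm_of_word big_nil odd_perm1.
rewrite -cat1s perm_of_word_cat perm_of_word1 odd_permM IHu size_cat oddD addbC.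
by rewrite /adj odd_tperm -val_eqE /= (ltn_eqF (ltnSn _)).
Qed.

Lemma size_reduced (s : 'S_n) : size (reduced s) = perm_length s.
Proof. exact: size_tuple. Qed.

Lemma reducedP (s : 'S_n) : perm_of_word (reduced s) = s.
Proof. exact/eqP/(xchooseP (reduced_subproof s)). Qed.

Lemma odd_perm_length (s : 'S_n) : odd (perm_length s) = s.
Proof. by rewrite -size_reduced -odd_perm_of_word reducedP. Qed.

Lemma perm_length_min (u : seq 'I_n.-1) : (perm_length (perm_of_word u) <= size u)%N.
Proof.
rewrite /perm_length; case: ex_minnP => m _; apply.
by apply/existsP; exists (in_tuple u).
Qed.

(** The inverse shuffle that brings the marked letters to the front; [insub] discards nothing, by
    [sorting_word_lt]. *)
Definition unshuffle (c : n.-tuple bool) : 'S_n :=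
  perm_of_word (pmap insub (sorting_word c) : seq 'I_n.-1).

Lemma map_val_sorting_word (c : n.-tuple bool) :
  map val (pmap insub (sorting_word c) : seq 'I_n.-1) = sorting_word c.
Proof.
have := sorting_word_lt c; rewrite size_tuple.
elim: (sorting_word c) => //= i u IHu /andP[lt_in lt_u].
by rewrite insubT => [|lt_in1]; [lia|rewrite /= IHu].
Qed.

Lemma size_unshuffle_word (c : n.-tuple bool) :
  size (pmap insub (sorting_word c) : seq 'I_n.-1) = inversions c.
Proof. by rewrite -(size_map val) map_val_sorting_word size_sorting_word. Qed.

Lemma unshuffle_enum (c : n.-tuple bool) (T : Type) (h : 'I_n -> T) :
  [seq h ((unshuffle c)^-1%g i) | i <- enum 'I_n]
  = mask c (map h (enum 'I_n)) ++ mask (map negb c) (map h (enum 'I_n)).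
Proof.
rewrite -braid_word_enum map_val_sorting_word braid_word_sorting_word //.
by rewrite size_map size_tuple size_enum_ord.
Qed.

End PermAction.

Lemma increasing_sorted m (h : 'I_m -> nat) :
  [forall i : 'I_m, forall j : 'I_m, (i < j)%N ==> (h i < h j)%N]
  = sorted ltn [seq h i | i <- enum 'I_m].
Proof.
apply/idP/idP => [/'forall_forallP Hh | Hs].
  rewrite sorted_map; apply: (@sub_sorted _ (relpre val ltn)).
    by move=> i j; apply/implyP/Hh.
  by rewrite -sorted_map val_enum_ord iota_ltn_sorted.
apply/'forall_forallP => i j; apply/implyP => lt_ij.
have := sorted_ltn_nth ltn_trans 0%N Hs.
rewrite -[size _]/(size (map h _)) size_map size_enum_ord.
move=> /(_ i j (ltn_ord i) (ltn_ord j) lt_ij).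
by rewrite !(nth_map i) -?enumT ?size_enum_ord ?nth_ord_enum.
Qed.

Lemma enum_ordD p q :
  enum 'I_(p + q) = map (@lshift p q) (enum 'I_p) ++ map (@rshift p q) (enum 'I_q).
Proof.
apply: (inj_map val_inj); rewrite val_enum_ord iotaD map_cat.
rewrite -(map_comp val (@lshift p q)) -(map_comp val (@rshift p q)).
rewrite -[iota 0 p]val_enum_ord; congr (_ ++ _).
rewrite -[X in iota X _]addn0 iotaDl -val_enum_ord -(map_comp (addn _) val).
exact: eq_map.
Qed.

Section Shuffles.

Variables p q : nat.
Implicit Types (s : 'S_(p + q)) (c : (p + q).-tuple bool).

Lemma shuffle_sorted s :
  shuffle s = sorted ltn [seq val (s (lshift q i)) | i <- enum 'I_p] &&
              sorted ltn [seq val (s (rshift p i)) | i <- enum 'I_q].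
Proof. by rewrite /shuffle -!increasing_sorted. Qed.

Definition shuffle_code s : (p + q).-tuple bool := [tuple ((s^-1)%g i < p)%N | i < p + q].

Lemma maskE c : mask c (enum 'I_(p + q)) = [seq i <- enum 'I_(p + q) | tnth c i].
Proof. by rewrite filter_mask map_tnth_enum. Qed.


Lemma mem_mask_tnth c i : (i \in mask c (enum 'I_(p + q))) = tnth c i.
Proof. by rewrite maskE mem_filter mem_enum andbT. Qed.

Lemma mask_negbE c :
  mask (map negb c) (enum 'I_(p + q)) = [seq i <- enum 'I_(p + q) | ~~ tnth c i].
Proof. by rewrite filter_mask -[in LHS](map_tnth_enum c) -(map_comp negb (tnth c)). Qed.

Lemma sorted_val_mask m : sorted (relpre val ltn) (mask m (enum 'I_(p + q))).
Proof.
by rewrite -sorted_map map_mask val_enum_ord (sorted_mask ltn_trans) // iota_ltn_sorted.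
Qed.

(** Each of the two blocks of values is increasing, and increasing lists with the same elements
    coincide. Thus a shuffle is determined by its code. *)
Lemma shuffle_enum s : shuffle s ->
  [seq s i | i <- enum 'I_(p + q)]
  = mask (shuffle_code s) (enum 'I_(p + q)) ++
    mask (map negb (shuffle_code s)) (enum 'I_(p + q)).
Proof.
have irr : irreflexive (relpre (val : 'I_(p + q) -> nat) ltn) by move=> i /=; rewrite ltnn.
have trans : transitive (relpre (val : 'I_(p + q) -> nat) ltn) by move=> i j k /=; apply: ltn_trans.
rewrite shuffle_sorted => /andP[sorted1 sorted2].
rewrite {1}enum_ordD map_cat.
rewrite -(map_comp s (@lshift p q)) -(map_comp s (@rshift p q)); congr (_ ++ _).
  apply: (irr_sorted_eq trans irr) => [||i].
  - by rewrite -sorted_map -(map_comp val).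
  - exact: sorted_val_mask.
  rewrite mem_mask_tnth tnth_mktuple; apply/mapP/idP => [[j _ ->] | lt_p].
    by rewrite /= permK /=.
  exists (Ordinal lt_p); first by rewrite mem_enum.
  by rewrite /= -[LHS](permKV s); congr (s _); apply: val_inj.
apply: (irr_sorted_eq trans irr) => [||i].
- by rewrite -sorted_map -(map_comp val).
- exact: sorted_val_mask.
rewrite mask_negbE mem_filter mem_enum andbT tnth_mktuple.
apply/mapP/idP => [[j _ ->] | ].
  by rewrite /= permK /= -leqNgt leq_addr.
case: (splitP ((s^-1)%g i)) => // j Ej _; exists j; first by rewrite mem_enum.
by rewrite /= -[LHS](permKV s); congr (s _); apply: val_inj; rewrite /= Ej.
Qed.

Lemma shuffle_codeK s : shuffle s -> ((unshuffle (shuffle_code s))^-1)%g = s.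
Proof.
move=> /shuffle_enum Es; apply/permP => i.
have := unshuffle_enum (shuffle_code s) id; rewrite !map_id -Es => /eq_in_map; apply.
by rewrite mem_enum.
Qed.

Lemma unshuffle_shuffle c : count id c = p -> shuffle ((unshuffle c)^-1)%g.
Proof.
move=> cnt; rewrite shuffle_sorted.
have szc : size (mask c (enum 'I_(p + q))) = p.
  by rewrite size_mask // size_tuple size_enum_ord.
have := unshuffle_enum c id; rewrite !map_id {1}enum_ordD map_cat.
rewrite -(map_comp _ (@lshift p q)) -(map_comp _ (@rshift p q)).
move=> /eqP; rewrite eqseq_cat; last by rewrite szc size_map size_enum_ord.
move=> /andP[/eqP E1 /eqP E2].
apply/andP; split.
  by have := sorted_val_mask c; rewrite -E1 -sorted_map -(map_comp val).
by have := sorted_val_mask (map negb c); rewrite -E2 -sorted_map -(map_comp val).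
Qed.

Lemma unshuffleK c : count id c = p -> shuffle_code ((unshuffle c)^-1)%g = c.
Proof.
move=> cnt; apply: eq_from_tnth => j; rewrite tnth_mktuple invgK.
set i := unshuffle c j; have -> : j = ((unshuffle c)^-1)%g i by rewrite /i permK.
have := unshuffle_enum c (tnth c); rewrite map_tnth_enum sorted_formE /sorted_form cnt.
have cnt' : count negb c = q by rewrite count_negb size_tuple cnt addKn.
move=> /(congr1 (fun t => nth false t i)).
rewrite (nth_map i) ?size_enum_ord // nth_ord_enum => ->.
by rewrite nth_cat size_nseq !nth_nseq; case: ltnP => // _; case: ifP.
Qed.

End Shuffles.

(** * Sums over marked words and the cup product *)

Section Bsum.

Variable K : comPzRingType.

Fixpoint bsum n (F : seq bool -> K) : K :=
  if n is n'.+1 then bsum n' (fun c => F (true :: c)) + bsum n' (fun c => F (false :: c))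
  else F [::].

Lemma sum_tuple_bool n (F : seq bool -> K) : \sum_(c : n.-tuple bool) F c = bsum n F.
Proof.
elim: n F => [|n IHn] F.
  rewrite /= (big_pred1 [tuple]) // => c; apply/esym/eqP; exact: tuple0.
pose h (bc : bool * n.-tuple bool) : n.+1.-tuple bool := [tuple of bc.1 :: bc.2].
rewrite (reindex h) /=; last first.
  exists (fun c => (thead c, [tuple of behead c])) => [[b c] _|c _]; last by rewrite [RHS]tuple_eta.
  by congr (_, _); apply: val_inj.
rewrite -(pair_big xpredT xpredT (fun b (c : n.-tuple bool) => F (b :: c))) /=.
by rewrite big_bool (IHn (fun c => F (true :: c))) (IHn (fun c => F (false :: c))).
Qed.

Lemma eq_bsum n (F G : seq bool -> K) : (forall c, size c = n -> F c = G c) ->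
  bsum n F = bsum n G.
Proof.
elim: n F G => [|n IHn] F G E /=; first exact: E.
by congr (_ + _); apply: IHn => c szc; rewrite E //= szc.
Qed.

Lemma bsumZ n (k : K) F : bsum n (fun c => k * F c) = k * bsum n F.
Proof. by elim: n F => //= n IHn F; rewrite !IHn mulrDr. Qed.

(** The two summands of - a; those of b are given by [letterB]. *)
Definition letterA (b : bool) : letter := (codeF b, codeG b).
Definition letterB (b : bool) : letter := (codeG b, codeF b).

Lemma bsumD n F G : bsum n (fun c => F c + G c) = bsum n F + bsum n G :> K.
Proof. by elim: n F G => //= n IHn F G; rewrite !IHn addrACA. Qed.

Lemma evalA_bsum n (phi : seq letter -> K) :
  evalA n phi = (-1) ^+ n * bsum n (fun c => phi (map letterA c)).
Proof.
elim: n phi => [|n IHn] phi /=; first by rewrite mul1r.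
rewrite IHn exprS -mulrA mulrCA; congr (_ * _).
rewrite -bsumD -bsumZ; apply: eq_bsum => c _.
by rewrite /opa mulN1r opprD.
Qed.

Lemma evalB_bsum n (phi : seq letter -> K) :
  evalB n phi = bsum n (fun c => phi (map letterB c)).
Proof. by elim: n phi => //= n IHn phi; rewrite IHn -bsumD. Qed.

End Bsum.

Lemma count_ltn_enum p q : count id (map (fun i : 'I_(p + q) => (i < p)%N) (enum 'I_(p + q))) = p.
Proof.
rewrite count_map -(count_map val (fun j => (j < p)%N)) val_enum_ord iotaD count_cat.
rewrite (@eq_in_count _ _ predT (iota 0 p)) => [|j]; last by rewrite mem_iota.
rewrite (@eq_in_count _ _ pred0 (iota _ q)) => [|j]; last first.
  by rewrite mem_iota add0n => /andP[le_pj _]; rewrite ltnNge le_pj.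
by rewrite count_predT count_pred0 size_iota addn0.
Qed.

Lemma kappa_letterA c : kappa (map letterA c) = inversions c.
Proof.
elim: c => //= b c ->; congr (_ + _)%N.
by rewrite /unzip1 -map_comp stars_codeF; case: b.
Qed.

(** A pair of a marked and an unmarked letter counts in [inversions] if the unmarked one comes
    first, and in [kappa] otherwise. *)
Lemma kappa_letterB c :
  (inversions c + kappa (map letterB c) = count id c * count negb c)%N.
Proof.
elim: c => //= b c IHc.
by rewrite /unzip1 -(map_comp _ letterB) stars_codeG; case: b => /=; lia.
Qed.

Section Cup.

Variables (X : Type) (sigma : X * X -> X * X) (K : comPzRingType).
Hypothesis sigma_braided : braided sigma.

Lemma concat_ext p q (f : cochain X K p) (g : cochain X K q) (v : (p + q).-tuple X) :
  concat f g v = ext f (take p v) * ext g (drop p v).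
Proof.
have E : tval v = [tuple tnth v (lshift q i) | i < p] ++ [tuple tnth v (rshift p i) | i < q].
  rewrite -{1}(map_tnth_enum v) enum_ordD map_cat.
  by rewrite -(map_comp _ (@lshift p q)) -(map_comp _ (@rshift p q)).
by rewrite E take_size_cat ?drop_size_cat ?size_tuple // !ext_tuple.
Qed.

(** [reduced] is an unspecified shortest expression, but the sorting word bounds its length by
    [inversions c], so [braid_word_multiface] applies. *)
Lemma T_perm_unshuffle n (c w : n.-tuple _) :
  tval (T_perm sigma (unshuffle c) w)
  = multiface sigma 0 (map codeF c) w ++ multiface sigma 0 (map codeG c) w.
Proof.
rewrite [LHS]/=; apply: braid_word_multiface => //; first by rewrite !size_tuple.
  by rewrite -{1}(map_tnth_enum c) braid_word_enum reducedP
    (unshuffle_enum c (tnth c)) map_tnth_enum sorted_formE.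
by rewrite size_map size_reduced -size_unshuffle_word perm_length_min.
Qed.

Lemma signr_unshuffle n (c : n.-tuple bool) :
  (-1) ^+ perm_length (unshuffle c)^-1%g = (-1) ^+ inversions c :> K.
Proof.
rewrite -signr_odd odd_perm_length odd_permV /unshuffle odd_perm_of_word.
by rewrite size_unshuffle_word signr_odd.
Qed.

Lemma cup_bsum p q (f : cochain X K p) (g : cochain X K q) (w : (p + q).-tuple X) :
  cup sigma f g w
  = bsum (p + q) (fun c => (-1) ^+ inversions c *
      (ext f (multiface sigma 0 (map codeF c) w) * ext g (multiface sigma 0 (map codeG c) w))).
Proof.
rewrite -sum_tuple_bool /cup.
rewrite (reindex_onto (fun c => (unshuffle c)^-1%g) (@shuffle_code p q)); last exact: shuffle_codeK.
(* Codes whose number of marks is not [p] contribute 0, since [f] is extended by zero. *)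
rewrite [RHS](bigID (fun c : (p + q).-tuple bool => count id c == p)) /=.
rewrite [X in _ = _ + X]big1 ?addr0 => [|c ne_p]; last first.
  by rewrite ext_size ?mul0r ?mulr0 // size_multiface size_map !size_tuple stars_codeF subKn //
    -[X in (_ <= X)%N](size_tuple c) count_size.
have codeP (c : (p + q).-tuple bool) :
    shuffle (unshuffle c)^-1%g && (shuffle_code (unshuffle c)^-1%g == c) = (count id c == p).
  apply/andP/eqP => [[_ /eqP Ec]|cnt]; last by rewrite unshuffle_shuffle ?unshuffleK.
  have := unshuffle_enum c (tnth c); rewrite map_tnth_enum sorted_formE.
  rewrite (@eq_map _ _ _ (fun i : 'I_(p + q) => (i < p)%N)); last first.
    by move=> i /=; rewrite -{1}Ec tnth_mktuple invgK permKV.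
  move=> /(congr1 (count id)); rewrite count_ltn_enum /sorted_form count_cat !count_nseq.
  by rewrite mul1n mul0n addn0.
apply: eq_big => // c; rewrite codeP => /eqP cnt.
rewrite signr_unshuffle invgK concat_ext T_perm_unshuffle.
have sz1 : size (multiface sigma 0 (map codeF c) w) = p.
  rewrite size_multiface size_map !size_tuple stars_codeF subKn //.
  by rewrite -[X in (_ <= X)%N](size_tuple c) count_size.
by rewrite take_size_cat ?drop_size_cat.
Qed.

Lemma cup_evalA p q (f : cochain X K p) (g : cochain X K q) (w : (p + q).-tuple X) :
  cup sigma f g w = (-1) ^+ (p + q) * evalA (p + q) (Psi sigma f g w).
Proof.
rewrite cup_bsum evalA_bsum mulrA -exprMn mulrNN mulr1 expr1n mul1r.
apply: eq_bsum => c _; rewrite /Psi /psi kappa_letterA.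
by rewrite /unzip1 /unzip2 -!(map_comp _ letterA).
Qed.

Lemma cup_evalB p q (f : cochain X K p) (g : cochain X K q) (w : (p + q).-tuple X) :
  cup sigma f g w = (-1) ^+ (p * q) * evalB (p + q) (Psi sigma g f w).
Proof.
rewrite cup_bsum evalB_bsum -bsumZ; apply: eq_bsum => c szc.
rewrite /Psi /psi /unzip1 /unzip2 -!(map_comp _ letterB).
have [cnt | ne_p] := eqVneq (count id c) p; last first.
  rewrite ![ext f _]ext_size ?(mul0r, mulr0) // size_multiface
    size_map size_tuple stars_codeF szc subKn //;
  by rewrite -szc count_size.
rewrite [RHS]mulrA [X in _ = _ * X]mulrC; congr (_ * (_ * _)).
have := kappa_letterB c; rewrite count_negb cnt szc addKn => <-.
by rewrite exprD -mulrA -exprMn mulrNN mulr1 expr1n mulr1.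
Qed.

End Cup.

(** * Circle products *)

Definition circle_letters (t : nat) (c : seq bool) : seq letter :=
  map letterA (take t c) ++ (None, None) :: map letterB (drop t.+1 c).

(** Position [t] carries the letter c, so entry [t] of the boolean word is irrelevant to the value;
    requiring it to be false counts each word once. *)
Lemma evalS_sum (K : comPzRingType) n (phi : seq letter -> K) :
  evalS n phi = \sum_(t < n) bsum n (fun c =>
    if nth false c t then 0 else (-1) ^+ t * phi (circle_letters t c)).
Proof.
elim: n phi => [|n IHn] phi; first by rewrite big_ord0.
rewrite big_ord_recl /= IHn evalB_bsum addrC; congr (_ + _).
  rewrite (_ : bsum n (fun=> 0) = 0) ?add0r; last first.
    by elim: (n) => //= m ->; rewrite addr0.
  by apply: eq_bsum => c _; rewrite /circle_letters /= drop0 mul1r.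
apply: eq_bigr => t _; rewrite -bsumD; apply: eq_bsum => c _ /=.
case: ifP => _; first by rewrite addr0.
by rewrite /bump /= add1n exprS /opa /circle_letters /=; ring.
Qed.

Section SplitEnum.

Variables (k : nat) (t : 'I_k).

Lemma enum_split : enum 'I_k = take t (enum 'I_k) ++ t :: drop t.+1 (enum 'I_k).
Proof.
rewrite -{1}(cat_take_drop t (enum 'I_k)) (drop_nth t) ?size_enum_ord //.
by rewrite nth_ord_enum.
Qed.

Lemma mem_take_enum i : i \in take t (enum 'I_k) -> (i < t)%N.
Proof.
move=> /(map_f val); rewrite map_take val_enum_ord take_iota mem_iota.
by rewrite add0n leq_min => /andP[_ /andP[]].
Qed.

Lemma mem_drop_enum i : i \in drop t.+1 (enum 'I_k) -> (t < i)%N.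
Proof.
by move=> /(map_f val); rewrite map_drop val_enum_ord drop_iota mem_iota => /andP[].
Qed.

Lemma map_enum_split (T : Type) (c : k.-tuple bool) (h : 'I_k -> T)
  (beta delta : bool -> T) (gamma : T) :
  (forall i : 'I_k, (i < t)%N -> h i = beta (tnth c i)) -> h t = gamma ->
  (forall i : 'I_k, (t < i)%N -> h i = delta (tnth c i)) ->
  [seq h i | i <- enum 'I_k]
  = map beta (take t c) ++ gamma :: map delta (drop t.+1 c).
Proof.
move=> lt_h ht gt_h; rewrite {1}enum_split map_cat /= ht.
rewrite -(map_tnth_enum c) -map_take -map_drop.
rewrite -(map_comp beta (tnth c)) -(map_comp delta (tnth c)); congr (_ ++ _ :: _).
  by apply/eq_in_map => i /mem_take_enum; apply: lt_h.
by apply/eq_in_map => i /mem_drop_enum; apply: gt_h.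
Qed.

End SplitEnum.

Lemma card_set_enum k (P : pred 'I_k) : #|[set i | P i]| = count id [seq P i | i <- enum 'I_k].
Proof. by rewrite cardsE cardE size_filter -enumT count_map; apply: eq_count. Qed.

(** The count behind [bracket L R], along a list of membership pairs: each index in [R] counts the
    later ones in [L]. *)
Fixpoint crossings (s : seq (bool * bool)) : nat :=
  if s is x :: s' then (x.2 * count id (unzip1 s') + crossings s')%N else 0.

Lemma bracket_crossings k (L R : {set 'I_k}) :
  bracket L R = crossings [seq (i \in L, i \in R) | i <- enum 'I_k].
Proof.
have E : bracket L R = (\sum_(j <- enum 'I_k) \sum_(i <- enum 'I_k)
    [&& j \in R, i \in L & (j < i)%N])%N.
  rewrite big_enum exchange_big big_enum pair_big /bracket -sum1dep_card.
  rewrite big_mkcond [RHS]big_mkcond; apply: eq_bigr => -[i j] _ /=.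
  by rewrite in_setX /=; case: (i \in L); case: (j \in R); case: ltnP.
rewrite {}E.
have: sorted (relpre val ltn) (enum 'I_k).
  by rewrite -sorted_map val_enum_ord iota_ltn_sorted.
elim: (enum 'I_k) => [|j s IHs] /=; first by rewrite big_nil.
rewrite path_sortedE; last by move=> ? ? ? /=; apply: ltn_trans.
move=> /andP[lt_js /IHs {}IHs].
rewrite !big_cons ltnn !andbF add0n -IHs; congr (_ + _)%N.
  rewrite /unzip1 -map_comp count_map; elim: (s) lt_js => [|i s' IHs'] /=.
    by rewrite big_nil muln0.
  move=> /andP[lt_ji /IHs' E]; rewrite big_cons E lt_ji andbT.
  by case: (j \in R); rewrite ?mul1n ?mul0n.
rewrite big_seq [RHS]big_seq; apply: eq_bigr => j' /(allP lt_js) /= lt_jj'.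
by rewrite big_cons ltnNge (ltnW lt_jj') /= !andbF.
Qed.

Lemma crossings_cat s s' :
  crossings (s ++ s')
  = (crossings s + crossings s' + count id (unzip2 s) * count id (unzip1 s'))%N.
Proof.
elim: s => /= [|x s ->]; first by rewrite addn0.
by rewrite /unzip1 map_cat count_cat; case: x.2 => /=; lia.
Qed.

Lemma crossings_false (T : Type) (s : seq T) :
  [/\ crossings [seq (false, false) | _ <- s] = 0%N,
      count id (unzip1 [seq (false, false) | _ <- s]) = 0%N &
      count id (unzip2 [seq (false, false) | _ <- s]) = 0%N].
Proof. by elim: s => //= x s [-> -> ->]. Qed.

Lemma crossings_negb c : crossings [seq (b, ~~ b) | b <- c] = inversions c.
Proof. by elim: c => //= b c ->; rewrite /unzip1 -map_comp (eq_map (g := id)) ?map_id. Qed.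

Section DWord.

Variables (X : Type) (sigma : X * X -> X * X) (K : comPzRingType).

Lemma d_word_face k u (h : seq X -> K) (w : k.-tuple X) :
  d_word sigma (u := u) (fun v => h (val v)) w
  = h (foldr (fun a v => face sigma a.2 a.1 v) (val w) u).
Proof.
elim: u h => //= -[i o] u IHu h /=.
by rewrite -(IHu (fun v => h (face sigma o i v))); case: o.
Qed.

(** The operator of largest index is outermost and so deletes its letter of [w] first, as in
    [multiface]. *)
Lemma d_LR_multiface p k (L R : {set 'I_k}) (h : cochain X K p) (w : k.-tuple X) :
  d_LR sigma L R h w = ext h (multiface sigma 0
    [seq if i \in L then Some true else if i \in R then Some false else None
      | i <- enum 'I_k] w).
Proof.
rewrite /d_LR [LHS](d_word_face _ (ext h)); congr (ext h _).
rewrite /LR_word.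
have -> : enum (L :|: R) = [seq i <- enum 'I_k | i \in L :|: R] by rewrite enumT.
have : map val (enum 'I_k) = iota 0 (size (enum 'I_k)) by rewrite val_enum_ord size_enum_ord.
elim: (enum 'I_k) 0%N => //= i s IHs m [Em Es].
rewrite inE -IHs //.
by case EL: (i \in L); case ER: (i \in R); rewrite //= Em ?EL.
Qed.

End DWord.

Lemma stars_cat c d : stars (c ++ d) = (stars c + stars d)%N.
Proof. by elim: c => //= -[o|] c ->. Qed.

Lemma kappa_cat u v :
  kappa (u ++ v) = (kappa u + kappa v + stars (unzip2 u) * stars (unzip1 v))%N.
Proof.
elim: u => [|[x y] u IHu] /=; first by rewrite addn0.
by rewrite IHu /unzip1 map_cat stars_cat; case: y => [o|] /=; lia.
Qed.

Section Circle.

Variables (X : Type) (sigma : X * X -> X * X) (K : comPzRingType).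

Section Decompositions.

Variables (k : nat) (t : 'I_k) (c : k.-tuple bool).

(* The entry true of c stands for J1 before position t and for I2 after it.    *)
Definition setI1 := [set i : 'I_k | ~~ tnth c i && (i < t)%N].
Definition setJ1 := [set i : 'I_k | tnth c i && (i < t)%N].
Definition setI2 := [set i : 'I_k | tnth c i && (t < i)%N].
Definition setJ2 := [set i : 'I_k | ~~ tnth c i && (t < i)%N].

Let u1 := take t c.
Let u2 := drop t.+1 c.

Lemma card_split (P : pred 'I_k) (beta delta : bool -> bool) :
  (forall i : 'I_k, (i < t)%N -> P i = beta (tnth c i)) -> P t = false ->
  (forall i : 'I_k, (t < i)%N -> P i = delta (tnth c i)) ->
  #|[set i | P i]| = (count beta u1 + count delta u2)%N.
Proof.
move=> lt_P Pt gt_P; rewrite card_set_enum (map_enum_split lt_P Pt gt_P).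
by rewrite count_cat /= !count_map.
Qed.

Lemma card_setI1 : #|setI1| = count negb u1.
Proof.
rewrite (@card_split _ negb (fun=> false)) ?count_pred0 ?addn0 ?ltnn ?andbF // => i lt_i.
  by rewrite lt_i andbT.
by rewrite ltnNge (ltnW lt_i) andbF.
Qed.

Lemma card_setJ1 : #|setJ1| = count id u1.
Proof.
rewrite (@card_split _ id (fun=> false)) ?count_pred0 ?addn0 ?ltnn ?andbF // => i lt_i.
  by rewrite lt_i andbT.
by rewrite ltnNge (ltnW lt_i) andbF.
Qed.

Lemma card_setI2 : #|setI2| = count id u2.
Proof.
rewrite (@card_split _ (fun=> false) id) ?count_pred0 ?add0n ?ltnn ?andbF // => i lt_i.
  by rewrite ltnNge (ltnW lt_i) andbF.
by rewrite lt_i andbT.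
Qed.

Lemma card_setJ2 : #|setJ2| = count negb u2.
Proof.
rewrite (@card_split _ (fun=> false) negb) ?count_pred0 ?add0n ?ltnn ?andbF // => i lt_i.
  by rewrite ltnNge (ltnW lt_i) andbF.
by rewrite lt_i andbT.
Qed.

Lemma bracket_setJ1 : bracket setJ1 setI1 = inversions u1.
Proof.
rewrite bracket_crossings.
rewrite (@map_enum_split _ t _ c _ (fun b => (b, ~~ b)) (fun=> (false, false)) (false, false)).
- have [cr0 c0 _] := crossings_false u2.
  by rewrite crossings_cat /= cr0 c0 crossings_negb !addn0 !muln0 !addn0.
- by move=> i lt_i; rewrite !inE lt_i !andbT.
- by rewrite !inE ltnn !andbF.
by move=> i lt_i; rewrite !inE ltnNge (ltnW lt_i) !andbF.
Qed.

Lemma bracket_setI2 : bracket setI2 setJ2 = inversions u2.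
Proof.
rewrite bracket_crossings.
rewrite (@map_enum_split _ t _ c _ (fun=> (false, false)) (fun b => (b, ~~ b)) (false, false)).
- have [cr0 _ c0] := crossings_false u1.
  by rewrite crossings_cat /= cr0 c0 crossings_negb !mul0n !add0n addn0.
- by move=> i lt_i; rewrite !inE ltnNge (ltnW lt_i) !andbF.
- by rewrite !inE ltnn !andbF.
by move=> i lt_i; rewrite !inE lt_i !andbT.
Qed.

Lemma d_LR_setI p (h : cochain X K p) (w : k.-tuple X) :
  d_LR sigma setI2 setI1 h w
  = ext h (multiface sigma 0 (unzip1 (circle_letters t c)) w).
Proof.
rewrite d_LR_multiface (@map_enum_split _ t _ c _ codeF codeG None).
- rewrite /circle_letters /unzip1 map_cat /=.
  by rewrite -(map_comp _ letterA) -(map_comp _ letterB).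
- move=> i lt_i; rewrite !inE lt_i ltnNge (ltnW lt_i) /= andbF andbT.
  by case: (tnth c i).
- by rewrite !inE ltnn !andbF.
move=> i lt_i; rewrite !inE lt_i [(i < t)%N]ltnNge (ltnW lt_i) /= andbF andbT.
by case: (tnth c i).
Qed.

Lemma d_LR_setJ p (h : cochain X K p) (w : k.-tuple X) :
  d_LR sigma setJ1 setJ2 h w
  = ext h (multiface sigma 0 (unzip2 (circle_letters t c)) w).
Proof.
rewrite d_LR_multiface (@map_enum_split _ t _ c _ codeG codeF None).
- rewrite /circle_letters /unzip2 map_cat /=.
  by rewrite -(map_comp _ letterA) -(map_comp _ letterB).
- move=> i lt_i; rewrite !inE lt_i [(t < i)%N]ltnNge (ltnW lt_i) /= andbF andbT.
  by case: (tnth c i).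
- by rewrite !inE ltnn !andbF.
move=> i lt_i; rewrite !inE lt_i [(i < t)%N]ltnNge (ltnW lt_i) /= andbF andbT.
by case: (tnth c i).
Qed.

Lemma stars_unzip1 : stars (unzip1 (circle_letters t c)) = (count id u1 + count negb u2).+1.
Proof.
rewrite /circle_letters /unzip1 map_cat /= -(map_comp _ letterA) -(map_comp _ letterB).
by rewrite stars_cat /= stars_codeF stars_codeG addnS.
Qed.

Lemma stars_unzip2 : stars (unzip2 (circle_letters t c)) = (count negb u1 + count id u2).+1.
Proof.
rewrite /circle_letters /unzip2 map_cat /= -(map_comp _ letterA) -(map_comp _ letterB).
by rewrite stars_cat /= stars_codeF stars_codeG addnS.
Qed.

(** Once [p], [q] and [t] are expressed by counts, and [kappa_letterB] relates [inversions u2] to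
    [kappa], both exponents have the same parity. *)
Lemma signr_circle p q :
  (count negb u1 + count id u2).+1 = q -> (count id u1 + count negb u2).+1 = p ->
  (-1) ^+ (q.-1 * count id u1 + inversions u1 + inversions u2)
  = (-1) ^+ (p.+1 * q) * ((-1) ^+ t * (-1) ^+ kappa (circle_letters t c)) :> K.
Proof.
move=> <- <-; rewrite -!exprD /circle_letters kappa_cat /= kappa_letterA.
rewrite /unzip2 -(map_comp _ letterA) stars_codeG /unzip1
  -(map_comp _ letterB) stars_codeG -/u1 -/u2.
have -> : t = (count id u1 + count negb u1)%N :> nat.
  by rewrite (count_predC id) size_takel // size_tuple ltnW.
have := kappa_letterB u2; rewrite -/u1 -/u2 => /(congr1 odd) E.
rewrite -signr_odd -[RHS]signr_odd; congr (_ ^+ nat_of_bool _); move: E.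
rewrite /= !(oddD, oddM, oddS) /=.
by case: (odd (inversions u2)); case: (odd (kappa _)); case: (odd (count id u1));
  case: (odd (count negb u1)); case: (odd (count id u2)); case: (odd (count negb u2));
  case: (odd (inversions u1)).
Qed.

Lemma decomposition_set p q :
  decomposition p q t setI1 setJ1 setI2 setJ2
  = ((count negb u1 + count id u2).+1 == q) && ((count id u1 + count negb u2).+1 == p).
Proof.
rewrite /decomposition card_setI1 card_setJ1 card_setI2 card_setJ2.
have -> : setI1 :|: setJ1 == [set i : 'I_k | (i < t)%N].
  by apply/eqP/setP => i; rewrite !inE; case: (tnth c i); rewrite /= ?orbF.
have -> : setI2 :|: setJ2 == [set i : 'I_k | (t < i)%N].
  by apply/eqP/setP => i; rewrite !inE; case: (tnth c i); rewrite /= ?orbF.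
have -> : [disjoint setI1 & setJ1].
  by rewrite -setI_eq0; apply/eqP/setP => i; rewrite !inE; case: (tnth c i); rewrite /= ?andbF.
have -> : [disjoint setI2 & setJ2].
  by rewrite -setI_eq0; apply/eqP/setP => i; rewrite !inE; case: (tnth c i); rewrite /= ?andbF.
by [].
Qed.

Lemma size_circle_letters : size (circle_letters t c) = k.
Proof.
rewrite /circle_letters size_cat /= !size_map size_takel ?size_drop size_tuple.
  by have := ltn_ord t; lia.
exact: ltnW.
Qed.

Lemma size_multiface_circle1 (w : k.-tuple X) :
  size (multiface sigma 0 (unzip1 (circle_letters t c)) w) = (count id u1 + count negb u2).+1.
Proof.
rewrite size_multiface size_tuple -stars_unzip1 -{1}size_circle_letters size_map subKn //.
by rewrite -(size_map fst) stars_size.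
Qed.

Lemma size_multiface_circle2 (w : k.-tuple X) :
  size (multiface sigma 0 (unzip2 (circle_letters t c)) w) = (count negb u1 + count id u2).+1.
Proof.
rewrite size_multiface size_tuple -stars_unzip2 -{1}size_circle_letters size_map subKn //.
by rewrite -(size_map snd) stars_size.
Qed.

End Decompositions.

(** For fixed [t], a decomposition is recovered from the union of J1 and I2. Words violating the
    cardinality conditions contribute 0 through [ext]. *)
Lemma circle_evalS p q (f : cochain X K p) (g : cochain X K q) (w : (p + q).-1.-tuple X) :
  circle sigma f g w = (-1) ^+ (p.+1 * q) * evalS (p + q).-1 (Psi sigma f g w).
Proof.
rewrite evalS_sum mulr_sumr; apply: eq_bigr => t _.
set k := (p + q).-1 in t w *.
do 3 rewrite pair_big_dep /=.
pose h (c : k.-tuple bool) := (setI1 t c, setJ1 t c, setI2 t c, setJ2 t c).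
pose h' (x : {set 'I_k} * {set 'I_k} * {set 'I_k} * {set 'I_k}) : k.-tuple bool :=
  [tuple (i \in x.1.1.2 :|: x.1.2) | i < k].
rewrite (reindex_onto h h') /=; last first.
  move=> [[[I1 J1] I2] J2] /= /and5P[/eqP E1 D1 /eqP E2 D2 _].
  have in1 i : (i \in I1) || (i \in J1) = (i < t)%N by rewrite -in_setU E1 inE.
  have in2 i : (i \in I2) || (i \in J2) = (t < i)%N by rewrite -in_setU E2 inE.
  have dis1 i : (i \in I1) && (i \in J1) = false.
    by apply/negP => /andP[iI iJ]; have := disjointFr D1 iI; rewrite iJ.
  have dis2 i : (i \in I2) && (i \in J2) = false.
    by apply/negP => /andP[iI iJ]; have := disjointFr D2 iI; rewrite iJ.
  have lt_gt i : (i < t)%N && (t < i)%N = false by case: ltngtP.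
  rewrite /h /h'; congr (_, _, _, _); apply/setP => i; rewrite inE tnth_mktuple /= inE;
  have := lt_gt i; rewrite -in1 -in2; have := dis1 i; have := dis2 i;
  by case: (i \in I1); case: (i \in J1); case: (i \in I2); case: (i \in J2).
rewrite -sum_tuple_bool mulr_sumr.
rewrite [LHS]big_mkcond; apply: eq_bigr => c _ /=.
rewrite d_LR_setI d_LR_setJ card_setJ1 bracket_setJ1 bracket_setI2.
(* The index [t] lies in none of the four sets, so only words with entry false at [t] are
   recovered. *)
have -> : (h' (h c) == c) = ~~ nth false c t.
  rewrite -tnth_nth; apply/eqP/idP => [<-|ct].
    by rewrite tnth_mktuple !inE ltnn !andbF.
  apply: eq_from_tnth => i; rewrite tnth_mktuple !inE -andb_orr -neq_ltn.
  by have [/val_inj -> | ] := eqVneq (i : nat) t; rewrite ?andbT // (negPf ct).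
have [ct|ct] := ifP (nth false c t); first by rewrite andbF mulr0.
rewrite andbT decomposition_set /Psi /psi.
case: eqP => [Eq|ne_q]; last first.
  by rewrite [ext g _]ext_size ?mulr0 // size_multiface_circle2; apply/eqP.
case: eqP => [Ep|ne_p]; last first.
  by rewrite [ext f _]ext_size ?(mul0r, mulr0) // size_multiface_circle1; apply/eqP.
rewrite (signr_circle Eq Ep).
by rewrite !mulrA.
Qed.

End Circle.

(* The tcasts only identify words of length p + q with words of length         *)
(* (p + (q + 1)) - 1 and q + p. The sign (-1)^(q-1) is written (-1)^(q+1), to  *)
(* avoid truncated subtraction at q = 0.                                       *)
Theorem theorem4 (X : Type) (sigma : X * X -> X * X)
  (sigma_braided : braided sigma) (K : comPzRingType) (p q : nat)
  (pq_ge2 : (2 <= p + q)%N) (f : cochain X K p) (g : cochain X K q)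
  (w : (p + q).-tuple X) :
  diff sigma (k := (p + q)%N) (circle sigma f g) w
  - (-1) ^+ q.+1 * circle sigma (diff sigma (k := p.+1) f) g w
  - circle sigma f (diff sigma (k := q.+1) g) (tcast (circle_degreeS p q) w)
  = (-1) ^+ q * (cup sigma g f (tcast (addnC p q) w)
                 - (-1) ^+ (p * q) * cup sigma f g w).
Proof.
rewrite (cup_evalA sigma_braided f g) (cup_evalB sigma_braided g f) !circle_evalS.
rewrite !val_tcast [(q + p)%N]addnC addnS.
have E : diff sigma (k := p + q) (circle sigma f g) w
  = (-1) ^+ (p.+1 * q) * insS (p + q).-1 (Psi sigma f g w).
  rewrite insS_Psi ?size_tuple ?prednK // ?(ltnW pq_ge2) //.
  rewrite mulr_sumr; apply: eq_bigr => i _.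
  by rewrite /d_l /d_r !circle_evalS; ring.
rewrite {}E.
have := evalS_fdiff (p + q) (Psi sigma f g w).
have insSE n phi : (0 < n)%N ->
  (if n is n'.+1 then insS n' phi else 0) = insS n.-1 phi :> K by case: n.
rewrite insSE; last exact: ltnW.
rewrite (@eq_evalS _ (p + q) _ _ (fun u szu =>
  fdiff_Psi sigma_braided f g (etrans szu (esym (size_tuple w))))).
rewrite evalS_lin mul1r /=.
set S1 := evalS _ _; set S2 := evalS _ _; set I := insS _ _.
set B := evalB _ _; set A := evalA _ _.
move=> /(canRL (addKr _)) ->.
(* The exponents come from the circle products of bidegrees (p+1, q), (p, q+1), (p, q) and from
   [cup_evalB]; the signs reduce to those of [p], [q] and [p * q]. *)
have -> : (p.+2 * q = q + (q + p * q))%N by lia.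
have -> : (p.+1 * q.+1 = p * q + p + q + 1)%N by lia.
have -> : (p.+1 * q = p * q + q)%N by lia.
have -> : (q * p = p * q)%N by lia.
rewrite !exprS !exprD ?expr0 ?expr1.
by case: (signrP K p) => ->; case: (signrP K q) => ->; case: (signrP K (p * q)) => ->; ring.
Qed.
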